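(* Let $K=P(n_1,\dots,n_k)$ be a pretzel knot with its standard diagram $D$, oriented, with $n=|n_1|+\dots+|n_k|$ crossings numbered $1,\dots,n$ as described in the context, and let $\Gamma$ be the balanced overlaid Tait graph obtained by omitting the unbounded region $U$ and the upper deck $R_{\mathrm{top}}$. Let $M$ be the $n\times n$ signed enhanced activity matrix: rows indexed by the crossings $1,\dots,n$, columns indexed by the $n$ regions other than $U$ and $R_{\mathrm{top}}$ (in any order), with entry $M_{c,R}=0$ if $R$ is not incident with crossing $c$, and otherwise $$M_{c,R}=\kappa(c,R)\,w(c)\,\alpha(c,R)|_V,$$ where $\alpha(c,R)$ is the activity letter of the edge of $\Gamma$ joining $c$ and $R$, $\alpha|_V$ is its evaluation given in the context, $w(c)=-A^{-3}$ if $c$ is a positive crossing of the oriented diagram (writhe contribution $+1$) and $w(c)=-A^{3}$ if it is negative, and $\kappa(c,R)=-1$ if $R$ is the region at $c$ lying between the two outgoing strand-ends of $c$ and $\kappa(c,R)=+1$ otherwise. Then, with $A=t^{-1/4}$, $$\det(M)=\pm V_K(t),$$ the Jones polynomial of $K$, up to sign.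
   Context: Pretzel diagram: for nonzero integers $n_1,\dots,n_k$, the diagram of $P(n_1,\dots,n_k)$ consists of $k$ vertical twist columns placed left to right, column $i$ being $|n_i|$ crossings between two strands stacked vertically; for $1\le i<k$ the top-right endpoint of column $i$ is joined to the top-left endpoint of column $i+1$ by a short arc, and likewise at the bottom; the top-left endpoint of column 1 is joined to the top-right endpoint of column $k$ by an arc passing above everything, and likewise at the bottom. $K$ is assumed to be a knot. Regions: the unbounded region $U$; the upper deck $R_{\mathrm{top}}$ (bounded by the upper outer arc and the tops of the columns and the top short arcs); the lower deck $R_{\mathrm{bot}}$; the $|n_i|-1$ regions inside column $i$ between consecutive crossings; and for $1\le i<k$ the region $W_i$ between columns $i$ and $i+1$. Black regions: $R_{\mathrm{top}},R_{\mathrm{bot}}$ and the regions inside columns; white regions: $U,W_1,\dots,W_{k-1}$. Crossings are numbered: column 1 top to bottom, then column 2 bottom to top, then each subsequent column bottom to top. Tait sign of a crossing: viewing it with the two black regions above and below, it is positive if the overstrand runs from lower left to upper right and negative otherwise; by convention the sign of $n_i$ is the Tait sign of the crossings of column $i$. Activity letter $\alpha(c,R)$ for crossing $c$ and incident non-omitted region $R$: internal ($L$ or $D$) if $R$ is black, external ($\ell$ or $d$) if $R$ is white; live ($L$ or $\ell$) if $c$ is the lowest-numbered crossing incident with $R$, dead ($D$ or $d$) otherwise; barred ($\overline{L},\overline{D},\overline{\ell},\overline{d}$) if $c$ has negative Tait sign. Evaluations $\alpha|_V$: $L\mapsto -A^{-3}$, $D\mapsto A$, $\ell\mapsto -A^{3}$,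 $d\mapsto A^{-1}$, $\overline{L}\mapsto -A^{3}$, $\overline{D}\mapsto A^{-1}$, $\overline{\ell}\mapsto -A^{-3}$, $\overline{d}\mapsto A$. Writhe sign of an oriented crossing is the usual $\pm1$ (right-handed crossing $+1$). $V_K(t)$ is the Jones polynomial (normalized so that the unknot has $V=1$). *)

(* Defs.v *)
From HB Require Import structures.
From mathcomp Require Import all_boot all_order all_algebra fraction.
Set Implicit Arguments.
Unset Strict Implicit.
Unset Printing Implicit Defensive.
Import Order.TTheory GRing.Theory Num.Theory.

(* The ring of coefficients: the field of fractions Q(A) = Frac(Z[A]);
   every quantity below is a Laurent polynomial in the indeterminate A. *)
Definition LA : Type := {fraction {poly int}}.
Definition varA : LA := FracField.tofrac ('X : {poly int}).

(* Diagram data.  ns = [:: n_1; ...; n_k]; columns are numbered 0..k-1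
   (left to right), rows inside column i are numbered 0..|n_i|-1 (top to
   bottom).  Crossings are numbered 0..n-1 following the paper's
   numbering 1..n (shifted by one): column 1 top to bottom, then each
   subsequent column bottom to top. *)
Section Pretzel.
Variable ns : seq int.

Definition pk : nat := size ns.
Definition pm (i : nat) : nat := `|nth 0%R ns i|%N.
Definition pre (i : nat) : nat := sumn [seq pm j | j <- iota 0 i].
Definition ncross : nat := pre pk.

Definition xing (i r : nat) : nat :=
  if i == 0%N then r else (pre i + (pm i - 1 - r))%N.

Definition colof (c : nat) : nat := count (fun i => pre i.+1 <= c) (iota 0 pk).
Definition rowof (c : nat) : nat :=
  let i := colof c in
  if i == 0%N then c else (pm i - 1 - (c - pre i))%N.

Definition tait_pos (c : nat) : bool := (0 < nth 0%R ns (colof c))%R.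

(* Positions (ends) of a crossing, in counterclockwise order:
     0 = NE, 1 = NW, 2 = SW, 3 = SE.
   The two strands through a crossing are {NE,SW} and {NW,SE}, i.e. the
   strand entering at position p leaves at position p+2 (mod 4).
   Corner q (q < 4) is the corner between positions q and q+1:
     corner 0 = North, 1 = West, 2 = South, 3 = East. *)

(* next / previous column, cyclically (the outer arcs close the cycle) *)
Definition cnext (i : nat) : nat := (i.+1 %% pk)%N.
Definition cprev (i : nat) : nat := ((i + pk).-1 %% pk)%N.

(* The arcs of the diagram: the other end (crossing, position) of the arc
   leaving crossing c at position p. *)
Definition mate (c p : nat) : nat * nat :=
  let i := colof c in let r := rowof c in let m := pm i in
  match p with
  | 0 => if (0 < r)%N then (xing i r.-1, 3) else (xing (cnext i) 0, 1)
  | 1 => if (0 < r)%N then (xing i r.-1, 2) else (xing (cprev i) 0, 0)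
  | 2 => if (r < m.-1)%N then (xing i r.+1, 1)
         else (xing (cprev i) (pm (cprev i)).-1, 3)
  | _ => if (r < m.-1)%N then (xing i r.+1, 0)
         else (xing (cnext i) (pm (cnext i)).-1, 2)
  end.

Inductive region : Type :=
  | RU
  | RTop
  | RBot
  | RIn of nat & nat       (* RIn i r : region in column i between rows r and r+1 *)
  | RW of nat.             (* RW i : region W_{i+1} between columns i and i+1 *)

Definition corner (c q : nat) : region :=
  let i := colof c in let r := rowof c in
  match q with
  | 0 => if r == 0%N then RTop else RIn i r.-1
  | 1 => if i == 0%N then RU else RW i.-1
  | 2 => if r == (pm i).-1 then RBot else RIn i r
  | _ => if i == pk.-1 then RU else RW i
  end.

Definition black (R : region) : bool :=
  match R with RTop | RBot | RIn _ _ => true | _ => false end.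

Definition omitted (R : region) : bool :=
  match R with RU | RTop => true | _ => false end.

(* over-strand: for a crossing of positive Tait sign (black regions N and
   S) the overstrand runs from lower left to upper right, i.e. occupies
   positions {0,2}; otherwise positions {1,3}.  ovpos c is one of them. *)
Definition ovpos (c : nat) : nat := if tait_pos c then 0%N else 1%N.

End Pretzel.

Definition region_enc (R : region) : nat * nat * nat :=
  match R with
  | RU => (0, 0, 0) | RTop => (1, 0, 0) | RBot => (2, 0, 0)
  | RIn i r => (3, i, r) | RW i => (4, i, 0) end%N.
Definition region_dec (t : nat * nat * nat) : option region :=
  match t with
  | (0, _, _) => Some RU | (1, _, _) => Some RTop | (2, _, _) => Some RBot
  | (3, i, r) => Some (RIn i r) | (4, i, _) => Some (RW i) | _ => None end%N.
Lemma region_encK : pcancel region_enc region_dec.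
Proof. by case. Qed.
HB.instance Definition _ := Countable.copy region (pcan_type region_encK).

Section Diagram.
Variable ns : seq int.
Local Notation n := (ncross ns).

Definition port : finType := ('I_n * 'I_4)%type.
Definition pnat (x : port) : nat * nat := (val x.1, val x.2).

Definition arcrel (x y : port) : bool := pnat y == mate ns (val x.1) (val x.2).

Definition thrurel (x y : port) : bool :=
  (y.1 == x.1) && (val y.2 == (val x.2 + 2) %% 4)%N.

Definition classes (e : rel port) : {set {set port}} :=
  [set [set y | connect e x y] | x : port].

Definition ncomponents : nat := #|classes (fun x y => arcrel x y || thrurel x y)|.
Definition is_knot : Prop := ncomponents = 1%N.

(* Kauffman's A-channel at a crossing joins the two regions swept out when
   the overstrand is rotated counterclockwise, i.e. the corners ovpos and
   ovpos+2.  The A-smoothing therefore joins the ends at relative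
   positions (1,2) and (3,0); the B-smoothing joins (0,1) and (2,3)
   (positions relative to ovpos). *)
Definition smooth_partner (sA : bool) (c p : nat) : nat :=
  let o := ovpos ns c in
  let rl := ((p + 4 - o) %% 4)%N in
  let pr := if sA then (3 - rl)%N else (if odd rl then rl.-1 else rl.+1) in
  ((pr + o) %% 4)%N.

Definition staterel (s : {ffun 'I_n -> bool}) (x y : port) : bool :=
  arcrel x y ||
  ((y.1 == x.1) && (val y.2 == smooth_partner (s x.1) (val x.1) (val x.2))).

Definition nloops (s : {ffun 'I_n -> bool}) : nat := #|classes (staterel s)|.

Local Open Scope ring_scope.

Definition kbracket : LA :=
  \sum_(s : {ffun 'I_n -> bool})
     varA ^ (#|[set c | s c]|%:Z - #|[set c | ~~ s c]|%:Z) *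
     (- varA ^+ 2 - varA ^- 2) ^+ (nloops s).-1.

(* An orientation says, for every port, whether the knot leaves the
   crossing through it (true = outgoing).  Each arc runs from an outgoing
   port to an incoming port, and each strand through a crossing enters at
   one end and leaves at the opposite end. *)
Definition is_orientation (o : port -> bool) : Prop :=
  (forall x y : port, arcrel x y -> o x != o y) /\
  (forall x y : port, thrurel x y -> o x != o y).

Definition pt (c : 'I_n) (p : nat) : port := (c, inord (p %% 4)).

(* writhe sign: the crossing is positive (right-handed) iff, going
   counterclockwise from the incoming end of the understrand, the next end
   is the outgoing end of the overstrand. *)
Definition wpos (o : port -> bool) (c : 'I_n) : bool :=
  let ov := ovpos ns (val c) in
  let uin := if ~~ o (pt c ov.+1) then ov.+1 else (ov + 3)%N in
  o (pt c uin.+1).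

Definition writhe (o : port -> bool) : int :=
  \sum_(c : 'I_n) (if wpos o c then 1 else -1)%R.

(* Jones polynomial V_K(t) written in the variable A, where t = A^(-4):
   V = (-A^3)^(-w(D)) <D>. *)
Definition jonesA (o : port -> bool) : LA :=
  (- varA ^+ 3) ^ (- writhe o) * kbracket.

Definition incident (c : nat) (R : region) : bool :=
  [exists q : 'I_4, corner ns c q == R].

Definition live (c : 'I_n) (R : region) : bool :=
  [forall c' : 'I_n, incident (val c') R ==> (c <= c')%N].

Definition activity_val (c : 'I_n) (R : region) : LA :=
  let a := if tait_pos ns (val c) then varA else varA^-1 in
  if black R then (if live c R then - a ^- 3 else a)      (* L / D (barred: a = A^-1) *)
  else (if live c R then - a ^+ 3 else a^-1).             (* l / d *)

Definition wfactor (o : port -> bool) (c : 'I_n) : LA :=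
  if wpos o c then - varA ^- 3 else - varA ^+ 3.

Definition kappa (o : port -> bool) (c : 'I_n) (R : region) : LA :=
  if [exists q : 'I_4, [&& o (pt c q), o (pt c q.+1) & corner ns (val c) q == R]]
  then -1 else 1.

Definition Mentry (o : port -> bool) (c : 'I_n) (R : region) : LA :=
  if incident (val c) R then kappa o c R * wfactor o c * activity_val c R else 0.

Definition is_region (R : region) : bool :=
  [exists c : 'I_n, incident (val c) R].

Definition column_order (col : 'I_n -> region) : Prop :=
  injective col /\
  (forall R : region, (is_region R && ~~ omitted R) <-> exists j, col j = R).

Definition activity_matrix (o : port -> bool) (col : 'I_n -> region) : 'M[LA]_n :=
  \matrix_(c < n, j < n) Mentry o c (col j).

End Diagram.

(* Main.v *)
Require Import Defs.
From HB Require Import structures.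
From mathcomp Require Import all_boot all_order all_algebra fraction.
From mathcomp Require Import fingroup perm.
From mathcomp Require Import zify ring.
Import GRing.Theory.
Local Open Scope ring_scope.
Set Implicit Arguments.
Unset Strict Implicit.
Unset Printing Implicit Defensive.

(** Both sides are computed.

    Bracket: a state is a choice, at every crossing, of a horizontal or a vertical
    smoothing.  If [H] crossings are smoothed horizontally and [v] columns are
    entirely vertical, the state has [H - k + 2 v + 2 [v = 0]] loops, so that the
    state sum factors over the columns: with [d = - A^2 - A^-2], [a = A] or [A^-1]
    according to the sign of [n_i], and
      [X_i = (- a^-3)^|n_i| - a^|n_i|],  [Y_i = X_i + d^2 a^|n_i|],
    one gets [d^(k+1) <D> = \prod Y_i + (d^2 - 1) \prod X_i].

    Determinant: around every arc of the diagram the product of the four signs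
    [kappa] is [-1], as it is for the constant choice [+1] on the north and west
    corners and [-1] on the south and east ones.  Hence the two sign patterns differ
    by row and column signs, and up to these the matrix depends only on the [n_i].
    Weighting the rows of a column by powers of [- a^-4] kills the entries of its inner
    regions; what remains is a [k x k] Hessenberg matrix with [- X_i] on the diagonal
    and [Y_i] above it, whose determinant is [± d^-1 (\prod Y_i + (d^2 - 1) \prod X_i)].

    The row factors [w(c)] contribute [(- A^3)^(- writhe)], and signs are
    disposed of by comparing squares in the field of fractions. *)

(** * Numbering of the crossings *)
Section Indexing.
Local Open Scope nat_scope.
Variable ns : seq int.
Hypothesis ns_neq0 : all (fun z : int => z != 0%R) ns.
Local Notation k := (pk ns).
Local Notation pm := (pm ns).
Local Notation pre := (pre ns).
Local Notation n := (ncross ns).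

Lemma pm_gt0 i : i < k -> 0 < pm i.
Proof.
by move=> lt_ik; rewrite absz_gt0; apply: (all_nthP 0%R ns_neq0).
Qed.

Lemma preS i : pre i.+1 = pre i + pm i.
Proof. by rewrite /Defs.pre -addn1 iotaD map_cat sumn_cat /= addn0. Qed.

Lemma leq_pre i j : i <= j -> pre i <= pre j.
Proof.
move=> /subnKC <-; elim: (j - i) => [|d IHd]; first by rewrite addn0.
by rewrite addnS preS (leq_trans IHd) ?leq_addr.
Qed.

Lemma ltn_pre i j t : i < j -> t < pm i -> pre i + t < pre j.
Proof.
by move=> lt_ij lt_t; rewrite (leq_trans _ (leq_pre lt_ij)) // preS ltn_add2l.
Qed.

Lemma ltn_ncross i t : i < k -> t < pm i -> pre i + t < n.
Proof. exact: ltn_pre. Qed.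

Lemma colof_pre i t : i < k -> t < pm i -> colof ns (pre i + t) = i.
Proof.
move=> lt_ik lt_t; rewrite /colof -{1}(subnKC (ltnW lt_ik)) iotaD count_cat add0n.
rewrite (eq_in_count (a2 := predT)) => [|j]; last first.
  rewrite mem_iota => /andP[_ lt_ji] /=.
  by rewrite (leq_trans (leq_pre lt_ji)) ?leq_addr.
rewrite [X in _ + X](eq_in_count (a2 := pred0)) => [|j]; last first.
  by rewrite mem_iota => /andP[le_ij _] /=; rewrite leqNgt ltn_pre.
by rewrite count_predT size_iota count_pred0 addn0.
Qed.

(** The column is an index of the predicate, so that case analysis replaces [c] and [colof ns c]
    together by expressions in a column and an offset. *)
Variant crossing_spec : nat -> nat -> Prop :=
  CrossingSpec i t of i < k & t < pm i : crossing_spec (pre i + t) i.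

Lemma crossingP c : c < n -> crossing_spec c (colof ns c).
Proof.
move=> lt_cn.
have [i lt_ik /andP[le_ic lt_ci]] :
    exists2 i, i < k & (pre i <= c < pre i.+1).
  move: lt_cn; rewrite /ncross; elim: (k) => [|j IHj] // lt_c.
  case: (ltnP c (pre j)) => [/IHj[i lt_ij i_c]|le_jc].
    by exists i => //; apply: ltnW.
  by exists j; rewrite ?le_jc.
rewrite preS in lt_ci.
have lt_t : c - pre i < pm i by rewrite ltn_subLR.
rewrite -(subnKC le_ic) colof_pre //; exact: CrossingSpec.
Qed.

(* Offsets number the crossings of a column, rows go from top to bottom; [flip] exchanges them. *)
Definition flip i t := if i == 0 then t else pm i - 1 - t.

Lemma flip_lt i t : t < pm i -> flip i t < pm i.
Proof. by rewrite /flip => lt_t; case: eqP => _ //; lia. Qed.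

Lemma flipK i t : t < pm i -> flip i (flip i t) = t.
Proof. by rewrite /flip => lt_t; case: eqP => _ //; lia. Qed.

Lemma xingE i r : xing ns i r = pre i + flip i r.
Proof. by rewrite /xing /flip; case: eqP => // ->. Qed.

Lemma rowof_pre i t : i < k -> t < pm i -> rowof ns (pre i + t) = flip i t.
Proof.
move=> lt_ik lt_t; rewrite /rowof colof_pre // /flip addKn.
by case: eqP => // ->.
Qed.

Lemma xing_lt i r : i < k -> r < pm i -> xing ns i r < n.
Proof. by move=> lt_ik lt_r; rewrite xingE ltn_ncross ?flip_lt. Qed.

Lemma colof_xing i r : i < k -> r < pm i -> colof ns (xing ns i r) = i.
Proof. by move=> lt_ik lt_r; rewrite xingE colof_pre ?flip_lt. Qed.

Lemma rowof_xing i r : i < k -> r < pm i -> rowof ns (xing ns i r) = r.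
Proof. by move=> lt_ik lt_r; rewrite xingE rowof_pre ?flipK ?flip_lt. Qed.

Lemma colof_lt c : c < n -> colof ns c < k.
Proof. by case/crossingP. Qed.

Lemma rowof_lt c : c < n -> rowof ns c < pm (colof ns c).
Proof. by case/crossingP=> i t lt_ik lt_t; rewrite rowof_pre ?flip_lt. Qed.

Lemma xing_colrow c : c < n -> xing ns (colof ns c) (rowof ns c) = c.
Proof. by case/crossingP=> i t lt_ik lt_t; rewrite xingE rowof_pre ?flipK. Qed.

Lemma cnext_lt i : i < k -> cnext ns i < k.
Proof. by move=> lt_ik; rewrite ltn_mod (leq_ltn_trans _ lt_ik). Qed.

Lemma cprev_lt i : i < k -> cprev ns i < k.
Proof. by move=> lt_ik; rewrite ltn_mod (leq_ltn_trans _ lt_ik). Qed.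

Lemma cnextK i : i < k -> cprev ns (cnext ns i) = i.
Proof.
move=> lt_ik; rewrite /cprev /cnext; have [eq_ik|neq_ik] := eqVneq i.+1 k.
  by rewrite eq_ik modnn add0n modn_small; lia.
rewrite (modn_small (m := i.+1)); last by lia.
by rewrite addSn /= modnDr modn_small.
Qed.

Lemma cprevK i : i < k -> cnext ns (cprev ns i) = i.
Proof.
move=> lt_ik; rewrite /cprev /cnext; case: i lt_ik => [|i] lt_ik.
  by rewrite add0n (modn_small (m := k.-1)) ?prednK ?modnn //; lia.
rewrite addSn /= modnDr [i %% _]modn_small ?modn_small //; lia.
Qed.

Lemma sum_offsets (R : Type) (idx : R) (op : Monoid.law idx) (F : nat -> R) :
  \big[op/idx]_(c < n) F c = \big[op/idx]_(i < k) \big[op/idx]_(t < pm i) F (pre i + t).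
Proof.
rewrite -(big_mkord predT F) /ncross.
elim: (k) => [|j IHj]; first by rewrite big_geq ?big_ord0.
rewrite big_ord_recr -IHj preS (big_cat_nat (n := pre j)) ?leq_addr //=.
congr (op _ _); rewrite -{1}[pre j]add0n big_addn addKn big_mkord.
by under eq_bigr do rewrite addnC.
Qed.

(** The order of the crossings runs through the columns by offsets; listing a column by rows may
    reverse it, hence the commutative law. *)
Lemma sum_columns (R : Type) (idx : R) (op : Monoid.com_law idx) (F : nat -> R) :
  \big[op/idx]_(c < n) F c = \big[op/idx]_(i < k) \big[op/idx]_(r < pm i) F (xing ns i r).
Proof.
rewrite sum_offsets.
apply: eq_bigr => i _; pose f (t : 'I_(pm i)) := Ordinal (flip_lt (ltn_ord t)).
have fK : involutive f by move=> t; apply: val_inj; rewrite /= flipK.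
by rewrite (reindex_inj (inv_inj fK)); apply: eq_bigr => t _; rewrite xingE /=.
Qed.

End Indexing.

(** * Arcs of the diagram *)

Section Ports.
Local Open Scope nat_scope.
Variable ns : seq int.
Hypothesis ns_neq0 : all (fun z : int => z != 0%R) ns.
Local Notation k := (pk ns).
Local Notation pm := (pm ns).
Local Notation n := (ncross ns).
Variable c0 : 'I_n.

(* The end [p] of the crossing in row [r] of column [i]; [c0] only serves as a default value. *)
Definition prt i r p : port ns := (insubd c0 (xing ns i r), inord p).

Lemma prt1 i r p : i < k -> r < pm i -> val (prt i r p).1 = xing ns i r.
Proof. by move=> lt_ik lt_r; rewrite /= val_insubd xing_lt. Qed.

Lemma prt2 i r p : p < 4 -> val (prt i r p).2 = p.
Proof. by move=> lt_p; rewrite /= inordK. Qed.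

Lemma portE (x : port ns) : x = prt (colof ns x.1) (rowof ns x.1) x.2.
Proof.
case: x => c p; congr (_, _); apply: val_inj.
  by rewrite val_insubd /= xing_colrow // ltn_ord.
by rewrite /= inordK.
Qed.

Variant port_spec : port ns -> Prop :=
  PortSpec i r p of i < k & r < pm i & p < 4 : port_spec (prt i r p).

Lemma portP x : port_spec x.
Proof. by rewrite [x]portE; apply: PortSpec; rewrite ?colof_lt ?rowof_lt. Qed.

Lemma prt_inj i r p i' r' p' :
  [&& i < k, r < pm i & p < 4] -> [&& i' < k, r' < pm i' & p' < 4] ->
  prt i r p = prt i' r' p' -> [/\ i = i', r = r' & p = p'].
Proof.
move=> /and3P[lt_i lt_r lt_p] /and3P[lt_i' lt_r' lt_p'] eq_prt.
have eq_x : xing ns i r = xing ns i' r' by rewrite -(prt1 p lt_i lt_r) eq_prt prt1.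
have eq_p : p = p' by rewrite -(prt2 i r lt_p) eq_prt prt2.
have eq_i : i = i' by rewrite -(colof_xing ns_neq0 lt_i lt_r) eq_x colof_xing.
by split=> //; rewrite -(rowof_xing ns_neq0 lt_i lt_r) eq_x rowof_xing.
Qed.

Lemma mate_xing i r p : i < k -> r < pm i ->
  mate ns (xing ns i r) p =
  match p with
  | 0 => if 0 < r then (xing ns i r.-1, 3) else (xing ns (cnext ns i) 0, 1)
  | 1 => if 0 < r then (xing ns i r.-1, 2) else (xing ns (cprev ns i) 0, 0)
  | 2 => if r < (pm i).-1 then (xing ns i r.+1, 1)
         else (xing ns (cprev ns i) (pm (cprev ns i)).-1, 3)
  | _ => if r < (pm i).-1 then (xing ns i r.+1, 0)
         else (xing ns (cnext ns i) (pm (cnext ns i)).-1, 2)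
  end.
Proof. by move=> lt_i lt_r; rewrite /mate colof_xing // rowof_xing. Qed.

Lemma arcrel_prt i r p i' r' p' :
  [&& i < k, r < pm i & p < 4] -> [&& i' < k, r' < pm i' & p' < 4] ->
  mate ns (xing ns i r) p = (xing ns i' r', p') -> arcrel (prt i r p) (prt i' r' p').
Proof.
move=> /and3P[lt_i lt_r lt_p] /and3P[lt_i' lt_r' lt_p'] eq_mate.
by rewrite /arcrel /Defs.pnat !prt1 // !prt2 // eq_mate.
Qed.

Lemma pm_last i : i < k -> (pm i).-1 < pm i.
Proof. by move=> lt_i; rewrite prednK // pm_gt0. Qed.

Lemma arc_left i r : i < k -> r.+1 < pm i -> arcrel (prt i r 2) (prt i r.+1 1).
Proof.
move=> lt_i lt_r; have lt_r0 := ltnW lt_r.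
by apply: arcrel_prt; rewrite ?mate_xing ?lt_i ?lt_r ?lt_r0 //= ifT //; lia.
Qed.

Lemma arc_right i r : i < k -> r.+1 < pm i -> arcrel (prt i r 3) (prt i r.+1 0).
Proof.
move=> lt_i lt_r; have lt_r0 := ltnW lt_r.
by apply: arcrel_prt; rewrite ?mate_xing ?lt_i ?lt_r ?lt_r0 //= ifT //; lia.
Qed.

Lemma arc_top i : i < k -> arcrel (prt i 0 0) (prt (cnext ns i) 0 1).
Proof.
move=> lt_i; have lt_c := cnext_lt lt_i.
by apply: arcrel_prt; rewrite ?mate_xing ?lt_i ?lt_c ?pm_gt0.
Qed.

Lemma arc_bot i : i < k ->
  arcrel (prt i (pm i).-1 3) (prt (cnext ns i) (pm (cnext ns i)).-1 2).
Proof.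
move=> lt_i; have lt_c := cnext_lt lt_i.
by apply: arcrel_prt; rewrite ?mate_xing ?lt_i ?lt_c ?pm_last //= ltnn.
Qed.

(** [arcrel] reads an arc from one end only. Symmetry says that [mate] is an involution, which is
    checked for each of the four ends, in inner and in extreme rows. *)
Lemma arcrel_sym : symmetric (@arcrel ns).
Proof.
suff sub (x y : port ns) : arcrel x y -> arcrel y x by move=> x y; apply/idP/idP; apply: sub.
case: (portP x) => i r p lt_i lt_r lt_p; case: (portP y) => i' r' p' lt_i' lt_r' lt_p'.
have lt_n := cnext_lt lt_i; have lt_v := cprev_lt lt_i.
rewrite /arcrel /Defs.pnat !prt1 // !prt2 // mate_xing // => /eqP.
have inj j s q : j < k -> s < pm j -> (xing ns i' r', p') = (xing ns j s, q) ->
    [/\ i' = j, r' = s & p' = q].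
  move=> lt_j lt_s [eq_x ->].
  have eq_j : i' = j by rewrite -(colof_xing ns_neq0 lt_i' lt_r') eq_x colof_xing.
  by split=> //; rewrite -(rowof_xing ns_neq0 lt_i' lt_r') eq_x rowof_xing.
case: p lt_p => [|[|[|[|//]]]] _; case: ifP => r_bd /inj[]; rewrite ?pm_last ?pm_gt0 //; try lia;
  move=> eq_i eq_r eq_p; subst i' r' p'; rewrite mate_xing ?cnextK ?cprevK ?ltnn //.
- by rewrite ifT ?prednK //; lia.
- by rewrite (_ : r = 0) //; lia.
- by rewrite ifT ?prednK //; lia.
- by rewrite (_ : r = 0) //; lia.
- by rewrite (_ : r = (pm i).-1) //; lia.
by rewrite (_ : r = (pm i).-1) //; lia.
Qed.

(** Up to direction there are four families of arcs: the left and right sides between consecutive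
    rows, and the top and bottom arcs to the cyclically next column. As [mate] is a function, one
    end of an arc determines the other. *)
Lemma arcrel_elim (Q : port ns -> port ns -> Prop) :
    (forall x y, Q x y -> Q y x) ->
    (forall i r, i < k -> r.+1 < pm i -> Q (prt i r 2) (prt i r.+1 1)) ->
    (forall i r, i < k -> r.+1 < pm i -> Q (prt i r 3) (prt i r.+1 0)) ->
    (forall i, i < k -> Q (prt i 0 0) (prt (cnext ns i) 0 1)) ->
    (forall i, i < k -> Q (prt i (pm i).-1 3) (prt (cnext ns i) (pm (cnext ns i)).-1 2)) ->
  forall x y, arcrel x y -> Q x y.
Proof.
move=> Qsym Ql Qr Qt Qb x y.
have uniq_arc (z : port ns) : arcrel x z -> arcrel x y -> y = z.
  move=> /eqP xz /eqP xy; rewrite [y]portE [z]portE.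
  by move: xz; rewrite -xy => -[-> ->].
case: (portP x) => i r p lt_i lt_r lt_p in uniq_arc *.
have lt_n := cnext_lt lt_i; have lt_v := cprev_lt lt_i.
case: p lt_p => [|[|[|[|//]]]] _ in uniq_arc *; [case: r => [|r] in lt_r uniq_arc *..| |].
- by move=> /(uniq_arc _ (arc_top lt_i))->; apply: Qt.
- have Axz := arc_right lt_i lt_r; rewrite arcrel_sym in Axz.
  by move=> /(uniq_arc _ Axz)->; apply/Qsym/Qr.
- have := arc_top lt_v; rewrite cprevK // arcrel_sym => Axz.
  by move=> /(uniq_arc _ Axz)->; apply/Qsym; rewrite -{2}(cprevK ns_neq0 lt_i); apply: Qt.
- have Axz := arc_left lt_i lt_r; rewrite arcrel_sym in Axz.
  by move=> /(uniq_arc _ Axz)->; apply/Qsym/Ql.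
- have [lt_r1|ge_r] := ltnP r.+1 (pm i).
    by move=> /(uniq_arc _ (arc_left lt_i lt_r1))->; apply: Ql.
  have eq_r : r = (pm i).-1 by lia.
  subst r; have := arc_bot lt_v; rewrite cprevK // arcrel_sym => Axz.
  by move=> /(uniq_arc _ Axz)->; apply/Qsym; rewrite -{3 4}(cprevK ns_neq0 lt_i); apply: Qb.
have [lt_r1|ge_r] := ltnP r.+1 (pm i).
  by move=> /(uniq_arc _ (arc_right lt_i lt_r1))->; apply: Qr.
have eq_r : r = (pm i).-1 by lia.
by subst r; move=> /(uniq_arc _ (arc_bot lt_i))->; apply: Qb.
Qed.

End Ports.

(** * Number of loops of a state *)

(** Since [rep] is constant on each class and takes its value there, each class contains exactly one
    fixed point of [rep]. *)
Lemma card_classes_rep (n : seq int) (e : rel (port n)) (rep : port n -> port n) :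
    symmetric e -> (forall x y, e x y -> rep x = rep y) ->
    (forall x, connect e x (rep x)) ->
  #|Defs.classes e| = #|[set x | rep x == x]|.
Proof.
move=> sym_e rep_e rep_conn; have csym := sym_connect_sym sym_e.
have rep_c x y : connect e x y -> rep x = rep y.
  case/connectP=> p; elim: p x => [|z p IHp] x /=; first by move=> _ ->.
  by move=> /andP[/rep_e-> /IHp] H /H.
have repK x : rep (rep x) = rep x by apply/esym/rep_c.
rewrite /Defs.classes.
have -> : [set [set y | connect e x y] | x : port n] =
          [set [set y | connect e x y] | x in [set x | rep x == x]].
  apply/setP=> S; apply/imsetP/imsetP=> [[x _ ->]|[x _ ->]]; last by exists x.
  exists (rep x); first by rewrite inE repK.
  by apply/setP=> y; rewrite !inE (same_connect csym (rep_conn x)).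
rewrite card_in_imset // => x y; rewrite !inE => /eqP rx /eqP ry eq_xy.
have: y \in [set z | connect e x z] by rewrite eq_xy inE connect0.
by rewrite inE => /rep_c; rewrite rx ry.
Qed.

(** All indices satisfying [h] but the last are followed by another. For the horizontal crossings of
    a column, they correspond to the loops closed off inside it. *)
Lemma sum_followed (h : nat -> bool) (m : nat) :
  (\sum_(r < m) (h r && has h (iota r.+1 (m - r.+1))) + has h (iota 0 m) =
  \sum_(r < m) h r)%N.
Proof.
elim: m h => [|m IHm] h; first by rewrite !big_ord0.
rewrite !big_ord_recl -(IHm (h \o S)) /= subSS subn0.
have hS b c : has h (iota b.+1 c) = has (h \o S) (iota b c).
  by rewrite -[b.+1]add1n iotaDl has_map.
rewrite hS; under [in LHS]eq_bigr => r _ do rewrite /bump /= add1n subSS hS.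
rewrite /bump /=; under [in RHS]eq_bigr => r _ do rewrite /=.
case: (h 0%N); case: (has _ _) => /=; lia.
Qed.

Section Loops.
Local Open Scope nat_scope.
Variable ns : seq int.
Hypothesis ns_neq0 : all (fun z : int => z != 0%R) ns.
Local Notation k := (pk ns).
Local Notation pm := (pm ns).
Local Notation n := (ncross ns).
Variable c0 : 'I_n.
Variable s : {ffun 'I_n -> bool}.
Local Notation prt := (prt c0).

(* With black regions above and below a crossing of positive Tait sign, the
   A-smoothing merges them, hence is vertical. *)
Definition horiz (c : 'I_n) := s c != tait_pos ns c.

Definition hz i r := horiz (insubd c0 (xing ns i r)).

(** Ends 0 and 1 are the upper ones, ends 1 and 2 the left ones. The Tait sign exchanges the shapes
    of the two smoothings; [horiz] absorbs this. *)
Lemma smooth_partnerE (c : 'I_n) (p : 'I_4) :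
  smooth_partner ns (s c) c p =
  if horiz c then (if odd p then p.-1 else p.+1) else 3 - p.
Proof.
rewrite /smooth_partner /horiz /ovpos; case: p => [[|[|[|[|//]]]] ? /=];
by case: (s c); case: (tait_pos ns c).
Qed.

Lemma staterel_sym : symmetric (staterel s).
Proof.
move=> x y; rewrite /staterel arcrel_sym //; congr (_ || _).
rewrite eq_sym; case: eqVneq => //= eq_xy; rewrite eq_xy !smooth_partnerE.
case: x y eq_xy => [c p] [d q] /= _; case: (horiz d);
by case: p => [[|[|[|[|//]]]] ? /=]; case: q => [[|[|[|[|//]]]] ? /=].
Qed.

Lemma staterel_elim (Q : port ns -> port ns -> Prop) :
    (forall x y, Q x y -> Q y x) ->
    (forall x y, arcrel x y -> Q x y) ->
    (forall i r, i < k -> r < pm i -> hz i r -> Q (prt i r 0) (prt i r 1)) ->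
    (forall i r, i < k -> r < pm i -> hz i r -> Q (prt i r 2) (prt i r 3)) ->
    (forall i r, i < k -> r < pm i -> ~~ hz i r -> Q (prt i r 1) (prt i r 2)) ->
    (forall i r, i < k -> r < pm i -> ~~ hz i r -> Q (prt i r 0) (prt i r 3)) ->
  forall x y, staterel s x y -> Q x y.
Proof.
move=> Qsym Qarc Qh1 Qh2 Qv1 Qv2 x y /orP[/Qarc //|/andP[/eqP eq_c]].
rewrite smooth_partnerE => /eqP.
case: (portP ns_neq0 c0 x) eq_c => i r p lt_i lt_r lt_p eq_c eq_q.
have -> : y = prt i r (if hz i r then (if odd p then p.-1 else p.+1) else 3 - p).
  case: y eq_c eq_q => d q /= -> eq_q; congr (_, _); apply: val_inj => /=.
  rewrite eq_q /hz /=; case: ifP => _;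
  by case: p lt_p {eq_q} => [|[|[|[|]]]] //= _; rewrite !inordK.
move: eq_q eq_c => _ _; have := Qh1 i r lt_i lt_r; have := Qh2 i r lt_i lt_r.
have := Qv1 i r lt_i lt_r; have := Qv2 i r lt_i lt_r.
case: (hz i r) => H1 H2 H3 H4; case: p lt_p => [|[|[|[|//]]]] _ /=;
by [apply: H1 | apply: H2 | apply: H3 | apply: H4
   | apply/Qsym/H1 | apply/Qsym/H2 | apply/Qsym/H3 | apply/Qsym/H4].
Qed.

(** * Paths along the strands of a state *)

Local Notation conn := (connect (staterel s)).

Let csym := sym_connect_sym staterel_sym.

Lemma hz_connect i r : i < k -> r < pm i -> hz i r ->
  conn (prt i r 0) (prt i r 1) && conn (prt i r 2) (prt i r 3).
Proof.
rewrite /hz => lt_i lt_r hz_ir.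
by apply/andP; split; apply: connect1; apply/orP; right;
   rewrite eqxx smooth_partnerE hz_ir /= !inordK.
Qed.

Lemma vt_connect i r : i < k -> r < pm i -> ~~ hz i r ->
  conn (prt i r 1) (prt i r 2) && conn (prt i r 0) (prt i r 3).
Proof.
rewrite /hz => lt_i lt_r /negPf hz_ir.
by apply/andP; split; apply: connect1; apply/orP; right;
   rewrite eqxx smooth_partnerE hz_ir /= !inordK.
Qed.

Lemma arc_connect x y : arcrel x y -> conn x y.
Proof. by move=> xy; apply: connect1; rewrite /staterel xy. Qed.

Definition hz_above i l := [seq r <- iota 0 l | hz i r].
Definition hz_below i l := has (hz i) (iota l (pm i - l)).

Lemma hz_aboveS i l :
  hz_above i l.+1 = if hz i l then rcons (hz_above i l) l else hz_above i l.
Proof.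
rewrite /hz_above -addn1 iotaD filter_cat /=.
by case: ifP; rewrite ?cats0 // cats1.
Qed.

Lemma hz_belowS i l : l < pm i -> hz_below i l = hz i l || hz_below i l.+1.
Proof. by move=> lt_l; rewrite /hz_below -[pm i - l]prednK ?subn_gt0 //= subnS. Qed.

(** From the upper ends of row [r], each side follows the vertical smoothings upwards. The nearest
    horizontal crossing above joins the two sides by its lower arc; without any, each side reaches
    the top on its own. *)
Lemma climb i r : i < k -> r < pm i ->
  if nilp (hz_above i r) then
    conn (prt i r 1) (prt i 0 1) && conn (prt i r 0) (prt i 0 0)
  else let z := prt i (last 0 (hz_above i r)) 2 in
    conn (prt i r 1) z && conn (prt i r 0) z.
Proof.
move=> lt_i; elim: r => [|r IHr] lt_r; first by rewrite !connect0.
have lt_r0 := ltnW lt_r; move/(_ lt_r0) in IHr.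
have Al := arc_connect (arc_left ns_neq0 c0 lt_i lt_r).
have Ar := arc_connect (arc_right ns_neq0 c0 lt_i lt_r).
rewrite csym in Al; rewrite csym in Ar.
rewrite hz_aboveS; case hz_r: (hz i r).
  rewrite /nilp size_rcons /= last_rcons Al (connect_trans Ar) //.
  by have /andP[_] := hz_connect lt_i lt_r0 hz_r; rewrite csym.
have /andP[Vl Vr] := vt_connect lt_i lt_r0 (negbT hz_r).
rewrite csym in Vl; rewrite csym in Vr.
have Bl := connect_trans Al Vl; have Br := connect_trans Ar Vr.
case: (nilp _) IHr => /= /andP[Cl Cr].
  by rewrite (connect_trans Bl) ?(connect_trans Br).
by rewrite (connect_trans Bl) ?(connect_trans Br).
Qed.

Lemma climb_low i r : i < k -> r < pm i ->
  if nilp (hz_above i r.+1) then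
    conn (prt i r 2) (prt i 0 1) && conn (prt i r 3) (prt i 0 0)
  else let z := prt i (last 0 (hz_above i r.+1)) 2 in
    conn (prt i r 2) z && conn (prt i r 3) z.
Proof.
move=> lt_i lt_r; have := climb lt_i lt_r; rewrite hz_aboveS.
case hz_r: (hz i r).
  rewrite /nilp size_rcons /= last_rcons connect0 /= => _.
  by have /andP[_] := hz_connect lt_i lt_r hz_r; rewrite csym.
have /andP[Vl Vr] := vt_connect lt_i lt_r (negbT hz_r).
rewrite csym in Vl; rewrite csym in Vr.
case: (nilp _) => /= /andP[Cl Cr].
  by rewrite (connect_trans Vl) ?(connect_trans Vr).
by rewrite (connect_trans Vl) ?(connect_trans Vr).
Qed.

(** * Representatives of the loops *)

Definition vertical i := ~~ has (hz i) (iota 0 (pm i)).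
Definition vcols := [seq i <- iota 0 k | vertical i].

(* The last vertical column strictly before column [i], in cyclic order. *)
Definition prevv i := last (last 0 vcols) [seq j <- iota 0 i | vertical j].

(** A vertical column joins the top of the adjacent gaps to their bottom, so [low] matters only when
    no column is vertical. Then one loop runs along the whole top and another along the whole
    bottom, and both are represented in column 0. *)
Definition lgap (low : bool) i :=
  if nilp vcols then (if low then prt 0 (pm 0).-1 3 else prt 0 0 0)
  else prt (prevv i) 0 0.
Definition rgap (low : bool) i :=
  if nilp vcols then (if low then prt 0 (pm 0).-1 3 else prt 0 0 0)
  else prt (if vertical i then i else prevv i) 0 0.

Lemma rgap_next low i : i < k -> rgap low i = lgap low (cnext ns i).
Proof.
move=> lt_i; rewrite /rgap /lgap; case: ifP => // /negbT nz_v; congr (prt _ 0 0).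
have prevvS : prevv i.+1 = if vertical i then i else prevv i.
  rewrite /prevv -addn1 iotaD filter_cat /= add0n.
  by case: ifP => _; rewrite ?cats0 // cats1 last_rcons.
(* At the last column, [prevv k] is the last element of [vcols], which is also the default value
   that yields [prevv 0]. *)
rewrite -prevvS /cnext; have [eq_ik|neq_ik] := eqVneq i.+1 k.
  by rewrite eq_ik modnn /prevv -/vcols; case: vcols nz_v.
by rewrite modn_small //; lia.
Qed.

Lemma prevvP i : ~~ nilp vcols -> i <= k -> vertical (prevv i) && (prevv i < k).
Proof.
move=> nz_v le_ik.
have vcolsP j : j \in vcols -> vertical j && (j < k).
  by rewrite mem_filter mem_iota.
apply/vcolsP; rewrite /prevv.
have last_v : last 0 vcols \in vcols by case: vcols nz_v => //= x l _; apply: mem_last.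
have := mem_last (last 0 vcols) [seq j <- iota 0 i | vertical j].
rewrite inE => /predU1P[-> //|].
rewrite !mem_filter !mem_iota /= !add0n => /andP[-> lt_l].
exact: leq_trans lt_l le_ik.
Qed.

(* Representative of the loop through the left or right side of column [i], just
   above row [l]: the horizontal crossing above it if the loop is closed off inside
   the column; otherwise the loop runs along the top or bottom of the diagram up to
   the next vertical columns, and is represented by the one to its left. *)
Definition rep_level i l (right : bool) :=
  let gap := if right then rgap else lgap in
  if nilp (hz_above i l) then gap false i
  else if hz_below i l then prt i (last 0 (hz_above i l)) 2
  else gap true i.

(** Ends 2 and 3 lie below their crossing, at the next level. The right-hand ends are 0 and 3, so
    the parity test is reversed for the lower ends. *)
Definition rep (x : port ns) :=
  rep_level (colof ns x.1) (rowof ns x.1 + (1 < x.2)) (~~ odd x.2 (+) (1 < x.2)).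

Lemma rep_prt i r p : i < k -> r < pm i -> p < 4 ->
  rep (prt i r p) = rep_level i (r + (1 < p)) (~~ odd p (+) (1 < p)).
Proof.
move=> lt_i lt_r lt_p.
by rewrite /rep prt1 // prt2 // colof_xing // rowof_xing.
Qed.

Lemma gap_nonvertical low i : ~~ vertical i -> rgap low i = lgap low i.
Proof. by rewrite /rgap => /negPf->. Qed.

Lemma nilp_above i : nilp (hz_above i (pm i)) = vertical i.
Proof. by rewrite /nilp size_filter -leqn0 leqNgt -has_count. Qed.

Lemma mem_vcols i : i < k -> vertical i -> i \in vcols.
Proof. by move=> lt_i v_i; rewrite mem_filter v_i mem_iota. Qed.

Lemma gap_low low low' i : i < k -> vertical i ->
  lgap low i = lgap low' i /\ rgap low i = rgap low' i.
Proof.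
move=> lt_i /(mem_vcols lt_i); rewrite /lgap /rgap.
by case: vcols.
Qed.

Lemma hz_vertical i r : r < pm i -> hz i r -> ~~ vertical i.
Proof.
by move=> lt_r hz_r; rewrite negbK; apply/hasP; exists r; rewrite ?mem_iota.
Qed.

Lemma rep_staterel x y : staterel s x y -> rep x = rep y.
Proof.
move: x y; apply: staterel_elim => [x y -> //| | | | |].
- apply: (arcrel_elim ns_neq0 (c0 := c0)) => [x y -> //|i r lt_i lt_r|i r lt_i lt_r|i lt_i|i lt_i].
  + by rewrite !rep_prt ?(ltnW lt_r) //= addn1 addn0.
  + by rewrite !rep_prt ?(ltnW lt_r) //= addn1 addn0.
  + have lt_n := cnext_lt lt_i.
    by rewrite !rep_prt ?pm_gt0 //= /rep_level /= rgap_next.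
  have lt_n := cnext_lt lt_i.
  rewrite !rep_prt ?pm_last //= !addn1 !prednK ?pm_gt0 // /rep_level /=.
  rewrite !nilp_above /hz_below !subnn /= !rgap_next //.
  (* At the bottom, a vertical column gives the gap with [low] false, any other column the gap with
     [low] true; these agree as soon as some column is vertical. *)
  case: ifP => v_i; case: ifP => v_n //.
  + by have [_] := gap_low false true lt_i v_i; rewrite !rgap_next.
  by have [] := gap_low false true lt_n v_n.
- move=> i r lt_i lt_r hz_r; rewrite !rep_prt //= addn0 /rep_level.
  by rewrite /= !gap_nonvertical ?(hz_vertical lt_r).
- move=> i r lt_i lt_r hz_r; rewrite !rep_prt //= addn1 /rep_level.
  by rewrite /= !gap_nonvertical ?(hz_vertical lt_r).
- move=> i r lt_i lt_r /negPf hz_r; rewrite !rep_prt //= addn0 addn1 /rep_level.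
  by rewrite hz_aboveS hz_r (hz_belowS lt_r) hz_r.
move=> i r lt_i lt_r /negPf hz_r; rewrite !rep_prt //= addn0 addn1 /rep_level.
by rewrite hz_aboveS hz_r (hz_belowS lt_r) hz_r.
Qed.

(** From column [v] the implications lead to the last column, round to column 0, and from there to
    all columns. *)
Lemma propagate_cyclic (L R : nat -> Prop) v :
    v < k -> R v -> (forall i, i < k -> L i -> R i) ->
    (forall i, i < k -> R i -> L (cnext ns i)) ->
  forall i, i < k -> L i /\ R i.
Proof.
move=> lt_v Rv LR RL.
have climbR d j : R j -> j + d < k -> R (j + d).
  move=> Rj; elim: d => [|d IHd]; first by rewrite addn0.
  rewrite addnS => lt_jd; have := RL _ (ltnW lt_jd) (IHd (ltnW lt_jd)).
  by rewrite /cnext modn_small //; apply: LR.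
have Rk : R k.-1.
  have -> : k.-1 = v + (k.-1 - v) by lia.
  by apply: climbR => //; lia.
have k_gt0 : 0 < k by lia.
have L0 : L 0.
  by have := RL k.-1; rewrite /cnext prednK // modnn; apply; rewrite // prednK.
have R0 : R 0 by apply: LR.
have Rall i : i < k -> R i by apply: (climbR i 0).
move=> i lt_i; split; last exact: Rall.
by rewrite -(cprevK ns_neq0 lt_i); apply: RL; [|apply: Rall]; apply: cprev_lt.
Qed.

Lemma gap_connect low i : i < k ->
  let r := if low then (pm i).-1 else 0 in
  conn (prt i r (if low then 2 else 1)) (lgap low i) /\
  conn (prt i r (if low then 3 else 0)) (rgap low i).
Proof.
move: i; pose row i := if low then (pm i).-1 else 0.
(* A column with a horizontal crossing joins its two sides at the top through the first such
   crossing, and at the bottom through the last one. *)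
have across i : i < k -> ~~ vertical i ->
    conn (prt i (row i) (if low then 2 else 1)) (prt i (row i) (if low then 3 else 0)).
  move=> lt_i nv_i; rewrite /row; case: (low).
    have := climb_low lt_i (pm_last ns_neq0 lt_i).
    rewrite prednK ?pm_gt0 // nilp_above (negPf nv_i) /= => /andP[C2 C3].
    by rewrite (connect_trans C2) // csym.
  rewrite /vertical negbK in nv_i; pose f := find (hz i) (iota 0 (pm i)).
  have lt_f : f < pm i by rewrite /f -{2}(size_iota 0 (pm i)) -has_find.
  have hz_f : hz i f by have := nth_find 0 nv_i; rewrite nth_iota.
  have := climb lt_i lt_f; rewrite ifT; last first.
    rewrite /nilp size_filter -leqn0 leqNgt -has_count; apply/hasPn=> j.
    rewrite mem_iota /= add0n => lt_j; have := before_find 0 lt_j.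
    by rewrite nth_iota ?(ltn_trans lt_j) // add0n => ->.
  move=> /andP[C1 C0]; have /andP[H01 _] := hz_connect lt_i lt_f hz_f.
  by rewrite csym in C1; rewrite (connect_trans C1) // (connect_trans _ C0) // csym.
(* The propagation starts at a column that contains the representative: the last vertical one, or
   column 0 if none is vertical. *)
have [v lt_v Rv] : exists2 v, v < k & conn (prt v (row v) (if low then 3 else 0)) (rgap low v).
  case nz_v: (nilp vcols).
    have lt_0 := leq_ltn_trans (leq0n _) (colof_lt (ltn_ord c0)).
    by exists 0 => //; rewrite /rgap nz_v /row; case: (low).
  have /andP[v_v lt_v] := prevvP (negbT nz_v) (leq0n k).
  exists (prevv 0) => //; rewrite /rgap nz_v v_v /row; case: (low) => //.
  have := climb_low lt_v (pm_last ns_neq0 lt_v).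
  by rewrite prednK ?pm_gt0 // nilp_above v_v /= => /andP[].
apply: (propagate_cyclic lt_v Rv) => i lt_i; last first.
  rewrite -rgap_next // => Ci; apply: connect_trans Ci; rewrite csym.
  rewrite /row; case: (low); apply: arc_connect; first exact: arc_bot.
  exact: arc_top.
have [v_i|nv_i] := boolP (vertical i); last first.
  rewrite gap_nonvertical // => Ci; apply: connect_trans Ci.
  by rewrite csym across.
move=> _; have nz_v : nilp vcols = false by have := mem_vcols lt_i v_i; case: vcols.
rewrite /rgap nz_v v_i /row; case: (low) => //.
have := climb_low lt_i (pm_last ns_neq0 lt_i).
by rewrite prednK ?pm_gt0 // nilp_above v_i /= => /andP[].
Qed.

Lemma rep_connect x : conn x (rep x).
Proof.
case: (portP ns_neq0 c0 x) => i r p lt_i lt_r lt_p; rewrite rep_prt //.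
have [Lt Rt] := gap_connect false lt_i; have [Lb Rb] := gap_connect true lt_i.
have : r + (1 < p) <= pm i /\ if nilp (hz_above i (r + (1 < p))) then
    conn (prt i r p) (prt i 0 (if ~~ odd p (+) (1 < p) then 0 else 1))
  else conn (prt i r p) (prt i (last 0 (hz_above i (r + (1 < p)))) 2).
  have := climb lt_i lt_r; have := climb_low lt_i lt_r.
  case: p lt_p => [|[|[|[|//]]]] _ /=; rewrite ?addn0 ?addn1;
  by do 2![case: ifP => _ /andP[? ?]]; split => //; apply: ltnW.
move: (r + _) (~~ odd p (+) _) => l right [le_l]; rewrite /rep_level.
case: ifP => [_|above] cl.
  by apply: (connect_trans cl); case: (right).
case: ifP => [//|below].
(* With no horizontal crossing from level [l] down, the nearest one above [l] is the last of the
   column, and the bottom of the column leads to it too. *)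
have same : last 0 (hz_above i l) = last 0 (hz_above i (pm i)).
  rewrite /hz_above -(subnKC le_l) iotaD filter_cat add0n.
  suff -> : [seq r <- iota l (pm i - l) | hz i r] = [::] by rewrite cats0.
  by apply/eqP; rewrite -size_eq0 size_filter -leqn0 leqNgt -has_count; apply: negbT.
have nv_i : ~~ vertical i.
  rewrite -nilp_above /hz_above -(subnKC le_l) iotaD filter_cat add0n.
  by move: above; rewrite /nilp size_cat addn_eq0 /hz_above => ->.
have := climb_low lt_i (pm_last ns_neq0 lt_i).
rewrite prednK ?pm_gt0 // nilp_above (negPf nv_i) -same /= => /andP[C2 _].
apply: (connect_trans cl); rewrite csym in C2; apply: (connect_trans C2).
by case: right; rewrite ?gap_nonvertical.
Qed.

Lemma nloops_rep : nloops s = #|[set x | rep x == x]|.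
Proof. exact: card_classes_rep staterel_sym rep_staterel rep_connect. Qed.

End Loops.

(** * Counting the representatives *)

Section LoopCount.
Local Open Scope nat_scope.
Variable ns : seq int.
Hypothesis ns_neq0 : all (fun z : int => z != 0%R) ns.
Local Notation k := (pk ns).
Local Notation pm := (pm ns).
Local Notation n := (ncross ns).
Variable c0 : 'I_n.
Variable s : {ffun 'I_n -> bool}.
Local Notation prt := (prt c0).
Local Notation hz := (hz c0 s).
Local Notation vertical := (vertical c0 s).
Local Notation vcols := (vcols c0 s).
Local Notation prevv := (prevv c0 s).
Local Notation rlevel := (rep_level c0 s).

Lemma eq_prt i r p i' r' p' :
  i < k -> r < pm i -> p < 4 -> i' < k -> r' < pm i' -> p' < 4 ->
  (prt i r p == prt i' r' p') = [&& i == i', r == r' & p == p'].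
Proof.
move=> lt_i lt_r lt_p lt_i' lt_r' lt_p'.
apply/eqP/and3P => [/(prt_inj ns_neq0)[]|[/eqP-> /eqP-> /eqP->] //];
  by rewrite ?lt_i ?lt_r ?lt_p ?lt_i' ?lt_r' ?lt_p' // => -> -> ->.
Qed.

Lemma last_above i l : ~~ nilp (hz_above c0 s i l) -> last 0 (hz_above c0 s i l) < l.
Proof.
move=> nz; have: last 0 (hz_above c0 s i l) \in hz_above c0 s i l.
  by case: hz_above nz => //= x t _; apply: mem_last.
by rewrite mem_filter mem_iota => /andP[].
Qed.

Lemma nilp_vcols_vertical i : i < k -> nilp vcols -> vertical i = false.
Proof.
move=> lt_i nil_v; apply: contraTF nil_v => v_i.
by have := mem_vcols lt_i v_i; case: vcols.
Qed.

(** The three terms are due, in this order, to end 2 of a horizontal crossing with another one below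
    it, to end 0 in the top row, and to end 3 in the bottom row. End 1 is never fixed. *)
Lemma fixed_ports i r : i < k -> r < pm i ->
  \sum_(p < 4) (rep c0 s (prt i r p) == prt i r p) =
  (hz i r && has (hz i) (iota r.+1 (pm i - r.+1)))
  + (r == 0) * (vertical i || nilp vcols && (i == 0))
  + (r == (pm i).-1) * (nilp vcols && (i == 0)).
Proof.
move=> lt_i lt_r; have k_gt0 := leq_ltn_trans (leq0n i) lt_i.
have pm0 := pm_gt0 ns_neq0 k_gt0; have pm1 := pm_last ns_neq0 k_gt0.
have pv j : ~~ nilp vcols -> j < k -> vertical (prevv j) && (prevv j < k).
  by move=> nz lt_j; rewrite prevvP // ltnW.
do 4!rewrite big_ord_recl; rewrite big_ord0 /bump /= !rep_prt //= !addn0 !addn1.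
have -> : (rlevel i r false == prt i r 1) = false.
  rewrite /rep_level /=; case: ifP => [_|/negbT/last_above lt_l].
    rewrite /lgap; case: ifP => [_|/negbT nz]; first by rewrite eq_prt // !andbF.
    have /andP[_ lt_v] := pv i nz lt_i.
    by rewrite eq_prt ?(pm_gt0 ns_neq0) // !andbF.
  case: ifP => _; first by rewrite eq_prt ?(ltn_trans lt_l) // !andbF.
  rewrite /lgap; case: ifP => [_|/negbT nz]; first by rewrite eq_prt // !andbF.
  have /andP[_ lt_v] := pv i nz lt_i.
  by rewrite eq_prt ?(pm_gt0 ns_neq0) // !andbF.
have -> : (rlevel i r true == prt i r 0) =
          (r == 0) && (vertical i || nilp vcols && (i == 0)).
  rewrite /rep_level /=; case: r lt_r => [|r] lt_r.
    rewrite /= /rgap; case: ifP => [nil_v|/negbT nz].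
      by rewrite eq_prt // nilp_vcols_vertical //= andbT eq_sym.
    rewrite orbF; case: ifP => v_i; first by rewrite eqxx.
    have /andP[v_v lt_v] := pv i nz lt_i.
    rewrite eq_prt ?(pm_gt0 ns_neq0) //= andbT.
    by apply: contraFF v_i => /eqP <-.
  case: ifP => [_|/negbT/last_above lt_l].
    rewrite /rgap; case: ifP => [_|/negbT nz]; first by rewrite eq_prt // !andbF.
    have /andP[_ lt_v] := pv i nz lt_i.
    by case: ifP => _; rewrite eq_prt ?(pm_gt0 ns_neq0) //= andbF.
  case: ifP => _; first by rewrite eq_prt ?(ltn_trans lt_l) // !andbF.
  rewrite /rgap; case: ifP => [_|/negbT nz]; first by rewrite eq_prt // !andbF.
  have /andP[_ lt_v] := pv i nz lt_i.
  by case: ifP => _; rewrite eq_prt ?(pm_gt0 ns_neq0) //= andbF.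
have -> : (rlevel i r.+1 false == prt i r 2) =
          hz i r && has (hz i) (iota r.+1 (pm i - r.+1)).
  rewrite /rep_level /= -/(hz_below c0 s i r.+1).
  case: ifP => [|/negbT nz_a].
    rewrite hz_aboveS; case: (hz i r); first by rewrite /nilp size_rcons.
    move=> _; rewrite /lgap; case: ifP => [_|/negbT nz]; first by rewrite eq_prt // !andbF.
    have /andP[_ lt_v] := pv i nz lt_i.
    by rewrite eq_prt ?(pm_gt0 ns_neq0) // !andbF.
  have lt_l := last_above nz_a.
  case: ifP => [_|_]; rewrite ?andbF ?andbT.
    rewrite eq_prt ?(leq_trans lt_l) // eqxx andbT /=.
    move: nz_a; rewrite hz_aboveS; case: (hz i r); first by rewrite last_rcons eqxx.
    by move=> /last_above; rewrite ltn_neqAle => /andP[/negPf].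
  rewrite /lgap; case: ifP => [_|/negbT nz]; first by rewrite eq_prt // !andbF.
  have /andP[_ lt_v] := pv i nz lt_i.
  by rewrite eq_prt ?(pm_gt0 ns_neq0) // !andbF.
have -> : (rlevel i r.+1 true == prt i r 3) =
          (r == (pm i).-1) && (nilp vcols && (i == 0)).
  have last_r : r == (pm i).-1 -> r.+1 = pm i.
    by move/eqP->; rewrite prednK ?pm_gt0.
  rewrite /rep_level /=; case: ifP => [nil_a|/negbT nz_a].
    transitivity false.
      rewrite /rgap; case: ifP => [_|/negbT nz]; first by rewrite eq_prt // !andbF.
      have /andP[_ lt_v] := pv i nz lt_i.
      by case: ifP => _; rewrite eq_prt ?(pm_gt0 ns_neq0) // !andbF.
    apply/esym/negP => /and3P[/last_r eq_r nil_v _].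
    by move: nil_a; rewrite eq_r nilp_above nilp_vcols_vertical.
  have lt_l := last_above nz_a.
  case: ifP => [below|_].
    rewrite eq_prt ?(leq_trans lt_l) // !andbF; apply/esym/negP => /and3P[/last_r eq_r _ _].
    by move: below; rewrite eq_r /hz_below subnn.
  rewrite /rgap; case: ifP => [_|/negbT nz].
    rewrite eq_prt //= andbT [LHS]andbC eq_sym.
    by have [->|] := eqVneq i 0; rewrite ?andbF ?andbT.
  rewrite andbF; have /andP[_ lt_v] := pv i nz lt_i.
  by case: ifP => _; rewrite eq_prt ?(pm_gt0 ns_neq0) // !andbF.
rewrite !mulnb; lia.
Qed.

(** A column with [h] horizontal crossings accounts for [h - 1] loops if [h > 0] and for one if it
    is vertical, that is, for [h - 1] plus twice the indicator of verticality. Two outer loops are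
    added when no column is vertical. The summand [k] avoids subtraction in [nat]. *)
Lemma nloops_count :
  nloops s + k = \sum_(c : 'I_n) horiz s c + (\sum_(i < k) vertical i).*2
                 + (~~ [exists i : 'I_k, vertical i]).*2.
Proof.
have k_gt0 := leq_ltn_trans (leq0n _) (colof_lt (ltn_ord c0)).
have -> : ~~ [exists i : 'I_k, vertical i] = nilp vcols.
  rewrite /nilp size_filter -leqn0 leqNgt -has_count; congr (~~ _).
  apply/existsP/hasP => [[i v_i]|[i]]; first by exists (val i); rewrite ?mem_iota ?ltn_ord.
  by rewrite mem_iota => lt_i v_i; exists (Ordinal lt_i).
have -> : \sum_(c : 'I_n) horiz s c = \sum_(i < k) \sum_(r < pm i) hz i r.
  rewrite -(sum_columns ns_neq0 _ (fun c => nat_of_bool (horiz s (insubd c0 c)))).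
  by apply: eq_bigr => c _; rewrite valKd.
rewrite (nloops_rep ns_neq0 c0) -sum1dep_card big_mkcond /=.
rewrite (eq_bigr (fun x : port ns => nat_of_bool (rep c0 s (x.1, x.2) == (x.1, x.2)))); last first.
  by case=> c p _ /=; case: eqP.
rewrite -(pair_big predT predT (fun c p => nat_of_bool (rep c0 s (c, p) == (c, p)))) /=.
pose F c := \sum_(p < 4) (rep c0 s (prt (colof ns c) (rowof ns c) p)
                          == prt (colof ns c) (rowof ns c) p).
rewrite (eq_bigr (fun c : 'I_n => F c)); last first.
  by move=> c _; apply: eq_bigr => p _; rewrite [(c, p)](portE ns_neq0 c0).
rewrite sum_columns //.
have sum1k : \sum_(i < k) 1 = k by rewrite sum1_card card_ord.
rewrite -[X in _ + X = _]sum1k -big_split /=.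
rewrite (eq_bigr (fun i : 'I_k => \sum_(r < pm i) hz i r + (vertical i).*2
                                  + (nilp vcols && (val i == 0)).*2)) => [|i _].
  rewrite !big_split /= -!addnA; congr (_ + _).
  congr (_ + _); first by rewrite -muln2 big_distrl; apply: eq_bigr => i _; rewrite -muln2.
  rewrite (bigD1 (Ordinal k_gt0)) //= andbT big1 ?addn0 // => i.
  by rewrite -val_eqE /= => /negPf->; rewrite andbF.
have lt_i := ltn_ord i; have pmi := pm_gt0 ns_neq0 lt_i; have pml := pm_last ns_neq0 lt_i.
rewrite (eq_bigr (fun r : 'I_(pm i) =>
  (hz i r && has (hz i) (iota r.+1 (pm i - r.+1)))
  + (val r == 0) * (vertical i || nilp vcols && (val i == 0))
  + (val r == (pm i).-1) * (nilp vcols && (val i == 0)))) => [|r _]; last first.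
  rewrite -fixed_ports //; apply: eq_bigr => p _.
  by rewrite colof_xing ?rowof_xing.
have pick j : j < pm i -> \sum_(r < pm i) (val r == j) = 1.
  move=> lt_j; rewrite (bigD1 (Ordinal lt_j)) //= eqxx big1 // => r.
  by rewrite -val_eqE /= => /negPf->.
rewrite !big_split /= -!big_distrl /= !pick //.
have := sum_followed (hz i) (pm i).
have : nilp vcols -> vertical i = false by apply: nilp_vcols_vertical.
rewrite -[has (hz i) (iota 0 _)]negbK -/(vertical i).
case: (nilp _) => [->//|_]; case: (vertical i); case: (val i == 0) => /=; lia.
Qed.

End LoopCount.

(** * The Kauffman bracket *)

(* Expanding the product over [i] as a sum over subsets turns the sum over all
   states into a sum of products of independent factors. *)
Lemma sum_states_blocks (F : comPzRingType) (C I : finType) (col : C -> I)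
    (tp : C -> bool) (w : C -> bool -> F) (y : F) :
  \sum_(s : {ffun C -> bool})
     (\prod_c w c (s c)) *
     \prod_i (if [forall c, (col c == i) ==> (s c == tp c)] then y else 1) =
  \prod_i (\prod_(c | col c == i) (w c (tp c) + w c (~~ tp c))
           + (y - 1) * \prod_(c | col c == i) w c (tp c)).
Proof.
pose blk i (s : {ffun C -> bool}) := [forall c, (col c == i) ==> (s c == tp c)].
pose W c := w c (tp c) + w c (~~ tp c).
have blkE i s : ((blk i s)%:R : F) = \prod_(c | col c == i) (s c == tp c)%:R.
  rewrite /blk; case: forallP => [s_tp|].
    by rewrite big1 // => c col_c; move: (s_tp c); rewrite col_c /= => ->.
  move/forallP; rewrite negb_forall => /existsP[c]; rewrite negb_imply => /andP[col_c neq_c].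
  by rewrite (bigD1 c) //= (negPf neq_c) mul0r.
(* The factor of a column is [1 + (y - 1) * blk]. In the expansion, [J] is the set of columns where
   the second term is chosen: there the state is forced, elsewhere each crossing is summed
   freely. *)
transitivity (\sum_(J in {set I}) \prod_i (if i \in J then y - 1 else 1) *
               \prod_c (if col c \in J then w c (tp c) else W c)).
  transitivity (\sum_(s : {ffun C -> bool}) \sum_(J in {set I}) (\prod_c w c (s c)) *
       \prod_i (if i \in J then (y - 1) * (blk i s)%:R else 1)).
    apply: eq_bigr => s _; rewrite -big_distrr /= -bigA_distr /=; congr (_ * _).
    apply: eq_bigr => i _; rewrite -/(blk i s).
    by case: (blk i s); rewrite /= ?mulr0 ?mulr1 ?add0r ?subrK.
  rewrite exchange_big /=; apply: eq_bigr => J _.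
  rewrite (eq_bigr (fun s : {ffun C -> bool} => \prod_i (if i \in J then y - 1 else 1) *
      \prod_c (w c (s c) * if col c \in J then (s c == tp c)%:R else 1))).
    rewrite -big_distrr /= -(bigA_distr_bigA (fun c b =>
      w c b * if col c \in J then (b == tp c)%:R else 1)).
    congr (_ * _); apply: eq_bigr => c _; rewrite big_bool /= /W.
    case: (col c \in J); case: (tp c) => /=; rewrite ?mulr1 ?mulr0 ?addr0 ?add0r //.
    by rewrite addrC.
  move=> s _; rewrite big_split /= [in RHS]mulrCA; congr (_ * _).
  rewrite (partition_big col predT) //= -big_split /=; apply: eq_bigr => i _.
  case: ifP => iJ.
    rewrite blkE; congr (_ * _); apply: eq_bigr => c /eqP col_c.
    by rewrite col_c iJ.
  by rewrite mul1r big1 // => c /eqP->; rewrite iJ.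
under [RHS]eq_bigr => i _ do rewrite addrC.
rewrite bigA_distr /=; apply: eq_bigr => J _.
rewrite (partition_big col predT) //= -big_split /=; apply: eq_bigr => i _.
case: ifP => iJ; rewrite ?mul1r; last by apply: eq_bigr => c /eqP->; rewrite iJ.
by congr (_ * _); apply: eq_bigr => c /eqP->; rewrite iJ.
Qed.

Lemma exp_cardB_prod (F : fieldType) (C : finType) (s : pred C) (A : F) : A != 0 ->
  A ^ (#|[set c | s c]|%:Z - #|[set c | ~~ s c]|%:Z) = \prod_c (if s c then A else A^-1).
Proof.
move=> A0; rewrite expfzDr // -exprnP -exprnN (bigID s) /= -exprVn; congr (_ * _).
  by rewrite (eq_bigr (fun=> A)) => [|c ->] //; rewrite prodr_const cardsE.
by rewrite (eq_bigr (fun=> A^-1)) => [|c /negPf->] //; rewrite prodr_const cardsE.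
Qed.

Section Bracket.
Variable ns : seq int.
Hypothesis ns_neq0 : all (fun z : int => z != 0) ns.
Hypothesis k_gt0 : (0 < size ns)%N.
Local Notation k := (pk ns).
Local Notation pm := (pm ns).
Local Notation n := (ncross ns).

Lemma ncross_gt0 : (0 < n)%N.
Proof. exact: (@ltn_ncross ns 0 0 k_gt0 (pm_gt0 ns_neq0 k_gt0)). Qed.

Let c0 : 'I_n := Ordinal ncross_gt0.

Definition cidx (c : 'I_n) : 'I_k := Ordinal (colof_lt (ltn_ord c)).

Lemma card_column (i : 'I_k) : #|[pred c | cidx c == i]| = pm i.
Proof.
rewrite -sum1_card big_mkcond /=.
rewrite (eq_bigr (fun c : 'I_n => if colof ns c == i then 1%N else 0%N)); last first.
  by move=> c _; rewrite inE -val_eqE.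
rewrite (sum_columns ns_neq0 _ (fun c => if colof ns c == i then 1%N else 0%N)).
rewrite (bigD1 i) //= [X in (_ + X)%N]big1 => [|j neq_ji].
  rewrite addn0 (eq_bigr (fun=> 1%N)) ?sum1_card ?card_ord // => r _.
  by rewrite colof_xing // eqxx.
by rewrite big1 // => r _; rewrite colof_xing // val_eqE (negPf neq_ji).
Qed.

Lemma vertical_forall (s : {ffun 'I_n -> bool}) (i : 'I_k) :
  vertical c0 s i = [forall c, (cidx c == i) ==> (s c == tait_pos ns c)].
Proof.
apply/hasPn/forallP => [nhz c | all_v r].
  apply/implyP => /eqP eq_i.
  have := nhz (rowof ns c); rewrite mem_iota -eq_i /= rowof_lt //.
  by rewrite /hz xing_colrow // valKd /horiz negbK; apply.
rewrite mem_iota /= add0n => lt_r; rewrite /hz /horiz negbK.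
have := all_v (insubd c0 (xing ns i r)).
by rewrite -val_eqE /= val_insubd xing_lt // colof_xing // eqxx.
Qed.

Lemma nloops_gt0 (s : {ffun 'I_n -> bool}) : (0 < nloops s)%N.
Proof.
rewrite card_gt0; apply/set0Pn.
by exists [set y | connect (staterel s) (c0, ord0) y]; apply/imsetP; exists (c0, ord0).
Qed.

(** This is the weight of a vertical smoothing in column [i]; a horizontal one has the inverse
    weight. *)
Definition asign (F : fieldType) (A : F) (i : nat) : F :=
  if (0 < nth 0 ns i)%R then A else A^-1.

(** The power [d ^+ k.+1] turns the exponent [(nloops s).-1] into [nloops s + k], known from
    [nloops_count]. A vertical column contributes [d ^+ 2], and the outer loops contribute
    [1 + (d ^+ 2 - 1)] times the indicator of the states without vertical column. So
    [sum_states_blocks] applies with [y = d ^+ 2] and with [y = 0]. *)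
Lemma state_sum (F : fieldType) (A d : F) :
  d ^+ k.+1 * (\sum_(s : {ffun 'I_n -> bool})
     (\prod_c (if s c then A else A^-1)) * d ^+ (nloops s).-1) =
  \prod_(i < k) ((asign A i + (asign A i)^-1 * d) ^+ pm i + (d ^+ 2 - 1) * asign A i ^+ pm i)
  + (d ^+ 2 - 1) *
    \prod_(i < k) ((asign A i + (asign A i)^-1 * d) ^+ pm i - asign A i ^+ pm i).
Proof.
pose tp (c : 'I_n) := tait_pos ns c.
pose w (c : 'I_n) (b : bool) : F := (if b then A else A^-1) * (if b != tp c then d else 1).
have block y :
    \prod_(i < k) ((asign A i + (asign A i)^-1 * d) ^+ pm i + (y - 1) * asign A i ^+ pm i) =
    \sum_(s : {ffun 'I_n -> bool}) (\prod_c w c (s c)) *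
       \prod_(i < k) (if vertical c0 s i then y else 1).
  transitivity (\prod_i (\prod_(c | cidx c == i) (w c (tp c) + w c (~~ tp c))
           + (y - 1) * \prod_(c | cidx c == i) w c (tp c))).
    apply: eq_bigr => i _; rewrite -card_column -!prodr_const.
    have aE c : cidx c == i -> asign A i = if tp c then A else A^-1 by move/eqP<-.
    congr (_ + _ * _); apply: eq_bigr => c /aE->; rewrite /w;
      by case: (tp c); rewrite /= ?mulr1 ?invrK.
  rewrite -sum_states_blocks; apply: eq_bigr => s _; congr (_ * _).
  by apply: eq_bigr => i _; rewrite vertical_forall.
have := block 0; rewrite sub0r; under eq_bigr do rewrite mulN1r; move=> ->.
rewrite (block (d ^+ 2)) big_distrr [in RHS]big_distrr /= -big_split /=.
apply: eq_bigr => s _; rewrite mulrCA -exprD addSn -addnS prednK ?nloops_gt0 //.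
rewrite addnC (nloops_count ns_neq0 c0) !exprD.
have -> : \prod_c w c (s c) =
    (\prod_c if s c then A else A^-1) * d ^+ (\sum_(c : 'I_n) horiz s c).
  rewrite big_split /= -prodrXr; congr (_ * _); apply: eq_bigr => c _.
  by rewrite -/(horiz s c); case: (horiz s c).
have -> : d ^+ (\sum_(i < k) vertical c0 s i).*2 =
    \prod_(i < k) (if vertical c0 s i then d ^+ 2 else 1).
  rewrite -muln2 mulnC exprM -prodrXr; apply: eq_bigr => i _.
  by case: (vertical c0 s i).
have -> : \prod_(i < k) (if vertical c0 s i then 0 else 1) =
    (~~ [exists i : 'I_k, vertical c0 s i])%:R :> F.
  case: existsP => [[i v_i]|nv]; first by rewrite (bigD1 i) //= v_i mul0r.
  by rewrite big1 // => i _; case: ifP => // v_i; case: nv; exists i.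
have -> : d ^+ (~~ [exists i : 'I_k, vertical c0 s i]).*2 =
    1 + (d ^+ 2 - 1) * (~~ [exists i : 'I_k, vertical c0 s i])%:R.
  by case: [exists _, _]; rewrite /= ?mulr0 ?addr0 // mulr1 addrC subrK.
case: existsP => [_|nv] /=; first by rewrite !(mulr0, addr0, mulr1) mulrA.
rewrite [\prod_(i < k) _]big1 => [|i _].
  by rewrite !mulr1 addrCA subrr addr0 mulrBl mul1r addrCA subrr addr0 mulrA mulrC.
by case: ifP => // v_i; case: nv; exists i.
Qed.

Lemma kbracket_state_sum :
  (- varA ^+ 2 - varA ^- 2) ^+ k.+1 * kbracket ns =
  let d := - varA ^+ 2 - varA ^- 2 in
  \prod_(i < k) ((asign varA i + (asign varA i)^-1 * d) ^+ pm i
                  + (d ^+ 2 - 1) * asign varA i ^+ pm i)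
  + (d ^+ 2 - 1) *
    \prod_(i < k) ((asign varA i + (asign varA i)^-1 * d) ^+ pm i - asign varA i ^+ pm i).
Proof.
have A0 : varA != 0 by rewrite tofrac_eq0 polyX_eq0.
rewrite /= -state_sum; congr (_ * _); apply: eq_bigr => s _.
by rewrite exp_cardB_prod.
Qed.

End Bracket.

(** * Determinant of the model matrix *)

(* In the Leibniz formula, [\sum_i h i] is invariant under [s], so that only [s = 1] survives. *)
Lemma det_trig_rank (R : comNzRingType) m (N : 'M[R]_m) (h : 'I_m -> nat) :
    injective h -> (forall i j, N i j != 0 -> (h i <= h j)%N) ->
  \det N = \prod_i N i i.
Proof.
move=> h_inj Nh; rewrite /determinant (bigD1 (1%g : {perm 'I_m})) //= odd_perm1 expr0 mul1r.
rewrite [X in _ + X]big1 ?addr0 => [|s neq_s1].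
  by apply: eq_bigr => i _; rewrite perm1.
have [|nz] := boolP [exists i, N i (s i) == 0].
  by case/existsP=> i /eqP Ni0; rewrite (bigD1 i) //= Ni0 mul0r mulr0.
have le_h i : (h i <= h (s i))%N.
  by apply: Nh; apply: contra nz => Ni0; apply/existsP; exists i.
case/eqP: neq_s1; apply/permP=> i; rewrite perm1; apply: h_inj; apply/eqP.
have eq_sum : (\sum_j h (s j) = \sum_j h j)%N.
  by rewrite [RHS](reindex_inj (@perm_inj _ s)).
have le_rest : (\sum_(j | j != i) h j <= \sum_(j | j != i) h (s j))%N.
  by apply: leq_sum => j _; apply: le_h.
move: eq_sum; rewrite (bigD1 i) //= [in RHS](bigD1 i) //=.
by move=> e; rewrite eqn_leq le_h andbT -(leq_add2r (\sum_(j | j != i) h j)) -e leq_add2l.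
Qed.

(** The common reordering of rows and columns contributes its sign twice. The two sizes are equal
    but may be different expressions, hence a bijection instead of a permutation. *)
Lemma det_mxsub_bij (R : comNzRingType) p m (f : 'I_p -> 'I_m) (M : 'M[R]_m) :
  bijective f -> \det (mxsub f f M) = \det M.
Proof.
move=> f_bij; have eq_pm : p = m by have := bij_eq_card f_bij; rewrite !card_ord.
subst p; have f_inj := bij_inj f_bij; pose s := perm f_inj.
have -> : mxsub f f M = row_perm s (col_perm s M).
  by apply/matrixP=> i j; rewrite !mxE !permE.
rewrite row_permE col_permE !det_mulmx !det_perm.
by rewrite odd_permV mulrC -mulrA -signr_addb addbb mulr1.
Qed.

Definition hessenberg (R : nzRingType) (B X Y : nat -> R) m : 'M[R]_m :=
  \matrix_(i, j) (if val j == 0%N then B i else if val j == val i then X i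
                  else if val j == i.+1 then Y i else 0).

(** Expansion along the last row, which has only its first and last entries. Deleting it with the
    first column leaves a lower triangular matrix with diagonal [Y]. *)
Lemma det_hessenbergS (R : comNzRingType) (B X Y : nat -> R) m :
  \det (hessenberg B X Y m.+2) =
  X m.+1 * \det (hessenberg B X Y m.+1) + (-1) ^+ m.+1 * B m.+1 * \prod_(j < m.+1) Y j.
Proof.
rewrite (expand_det_row _ ord_max) [LHS]big_ord_recl [X in _ + X = _]big_ord_recr /=.
rewrite big1 ?add0r; last first.
  move=> j _; rewrite /hessenberg !mxE /= /bump /= add1n !eqSS (ltn_eqF (ltn_ord j)).
  by rewrite (ltn_eqF (ltnW (ltn_ord j : j.+1 < m.+1)%N)) mul0r.
rewrite addrC; congr (_ + _); last first.
  rewrite /cofactor /= addn0 mulrCA mulrA; congr (_ * _); first by rewrite mxE.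
  rewrite det_trig.
    apply: eq_bigr => i _; rewrite !mxE /= /bump /= !add1n leqNgt ltn_ord /= add0n.
    by rewrite (gtn_eqF (ltnSn i)) eqxx.
  apply/is_trig_mxP => i j lt_ij; rewrite !mxE /= /bump /= !add1n leqNgt ltn_ord /= add0n.
  by rewrite (gtn_eqF (ltnW _)) ?eqSS ?(gtn_eqF lt_ij).
rewrite [_ ord_max _]mxE /= /bump /= add1n eqxx /cofactor /= /bump /= add1n.
rewrite -signr_odd oddD addbb mul1r.
congr (_ * \det _); apply/matrixP=> i j; rewrite !mxE /= /bump /= !add1n.
by rewrite (leqNgt _ i) (leqNgt _ j) !ltn_ord.
Qed.

(** * Row reduction of the model matrix *)

Section ModelMatrix.
Variable ns : seq int.
Hypothesis ns_neq0 : all (fun z : int => z != 0) ns.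
Hypothesis k_gt0 : (0 < size ns)%N.
Local Notation k := (pk ns).
Local Notation pm := (pm ns).
Local Notation pre := (pre ns).
Local Notation n := (ncross ns).
Variable (F : fieldType) (A : F).
Hypothesis A_neq0 : A != 0.
Local Notation a := (asign ns A).
Let d : F := - A ^+ 2 - A ^- 2.

Definition offset (c : nat) : nat := (c - pre (colof ns c))%N.

Lemma offset_pre i t : (i < k)%N -> (t < pm i)%N -> offset (pre i + t) = t.
Proof. by move=> lt_i lt_t; rewrite /offset colof_pre // addKn. Qed.

Lemma pre_offset c : (c < n)%N -> (pre (colof ns c) + offset c)%N = c.
Proof. by case/crossingP=> i t lt_i lt_t; rewrite offset_pre. Qed.

Lemma offset_lt c : (c < n)%N -> (offset c < pm (colof ns c))%N.
Proof. by case/crossingP=> i t lt_i lt_t; rewrite offset_pre. Qed.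

(* Rows are indexed by the crossing at offset [t] of column [i].  The column
   [(j, s)] stands for the region between the crossings at offsets [s - 1] and
   [s] of column [j] if [s > 0], and for [W_(j-1)], or [RBot] when [j = 0], if [s = 0]. *)
Definition model_entry (i t j s : nat) : F :=
  if s != 0%N then
    if i == j then (if t == s then a i else if t.+1 == s then a i ^- 3 else 0) else 0
  else if j == 0%N then
    if i == 0%N then (if t.+1 == pm 0 then a i ^- 3 else 0)
    else (if t == 0%N then - a i else 0)
  else if i == j then (a i)^-1
  else if i.+1 == j then (if t == 0%N then a i ^+ 3 else - (a i)^-1)
  else 0.

Definition model_matrix : 'M[F]_n :=
  \matrix_(c, e) model_entry (colof ns c) (offset c) (colof ns e) (offset e).

(** Row [t] of column [i] gets the weight [lam i * q i ^+ t]. The ratio solves [q * a + a ^- 3 = 0],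
    which cancels the two entries of an inner region; it also satisfies [d = a ^+ 2 * (q - 1)],
    which evaluates the geometric sums. *)
Let q i : F := - a i ^- 4.
Let lam i : F := - d * a i ^+ (pm i).-1.
Let X i : F := (a i + (a i)^-1 * d) ^+ pm i - a i ^+ pm i.
Let Y i : F := (a i + (a i)^-1 * d) ^+ pm i + (d ^+ 2 - 1) * a i ^+ pm i.
Let B i : F := if i == 0%N then d * (a 0 + (a 0)^-1 * d) ^+ pm 0 else d * a i ^+ pm i.

Lemma asign_neq0 i : a i != 0.
Proof. by rewrite /asign; case: ifP; rewrite ?invr_eq0. Qed.

Lemma asign_d i : d = - a i ^+ 2 - a i ^- 2.
Proof. by rewrite /asign /d; case: ifP => // _; rewrite exprVn invrK addrC. Qed.

(** This is the factor by which a curl multiplies the bracket. *)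
Lemma curlE i : a i + (a i)^-1 * d = - a i ^- 3.
Proof. by rewrite (asign_d i); field; rewrite asign_neq0. Qed.

Lemma curl_pow i m : (a i + (a i)^-1 * d) ^+ m = a i ^+ m * q i ^+ m.
Proof. by rewrite curlE -exprMn; congr (_ ^+ _); rewrite /q; field; rewrite asign_neq0. Qed.

Lemma sum_lam i : (i < k)%N -> \sum_(t < pm i) lam i * q i ^+ t * (a i)^-1 = - X i.
Proof.
move=> lt_i; rewrite -mulr_suml -mulr_sumr /X curl_pow.
have -> : a i ^+ pm i * q i ^+ pm i - a i ^+ pm i = a i ^+ pm i * (q i ^+ pm i - 1).
  by rewrite mulrBr mulr1.
have a_pm : a i ^+ pm i = a i * a i ^+ (pm i).-1.
  by rewrite -exprS prednK // pm_gt0.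
rewrite subrX1 a_pm /lam.
move: (\sum_(t < _) _) (a i ^+ _) => G b; rewrite (asign_d i) /q.
by field; rewrite asign_neq0.
Qed.

Lemma sum_pick (R : pzSemiRingType) m (G : nat -> R) e j : (j < m)%N ->
  \sum_(t < m) G t * (if val t == j then e else 0) = G j * e.
Proof.
move=> lt_j; rewrite (bigD1 (Ordinal lt_j)) //= eqxx big1 ?addr0 // => t.
by rewrite -val_eqE /= => /negPf->; rewrite mulr0.
Qed.

(** Left multiplication by this matrix puts the weighted sum of the rows of each column in place of
    its row at offset 0. *)
Definition row_op (i t j s : nat) : F :=
  if t == 0%N then (if i == j then lam i * q i ^+ s else 0)
  else ((i == j) && (t == s))%:R.

Definition row_op_matrix : 'M[F]_n :=
  \matrix_(c, e) row_op (colof ns c) (offset c) (colof ns e) (offset e).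

Lemma special_row i j s : (i < k)%N -> (j < k)%N -> (s < pm j)%N ->
  \sum_(t < pm i) lam i * q i ^+ t * model_entry i t j s =
  if s != 0%N then 0
  else if j == 0%N then B i else if j == i then - X i else if j == i.+1 then Y i else 0.
Proof.
move=> lt_i lt_j lt_s; have a0 := asign_neq0 i.
have pmi := pm_gt0 ns_neq0 lt_i; have q0 : q i = - a i ^- 4 by [].
have a_pm : a i ^+ pm i = a i * a i ^+ (pm i).-1 by rewrite -exprS prednK.
have q_pm : q i ^+ pm i = q i * q i ^+ (pm i).-1 by rewrite -exprS prednK.
rewrite /model_entry; case: s lt_s => [|s] lt_s /=.
  have [j0|nj0] := eqVneq j 0%N.
    have [i0|ni0] := eqVneq i 0%N.
      subst i.
      rewrite (eq_bigr (fun t : 'I_(pm 0) => lam 0 * q 0 ^+ t *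
          (if val t == (pm 0).-1 then a 0 ^- 3 else 0))) => [|t _].
        rewrite (sum_pick (fun t => lam 0 * q 0 ^+ t)) ?prednK // /B eqxx curl_pow a_pm.
        rewrite q_pm /lam q0; move: (_ ^+ _) (_ ^+ _) => u v.
        by field.
      by rewrite -[Z in _ == Z](prednK pmi) eqSS.
    rewrite (sum_pick (fun t => lam i * q i ^+ t)) // /B (negPf ni0) a_pm /lam expr0; ring.
  rewrite [j == i]eq_sym; have [eq_ij|neq_ij] := eqVneq i j; first exact: sum_lam.
  rewrite [j == _]eq_sym; have [eq_ij|_] := eqVneq i.+1 j.
    (* The entries are the opposite of the inverse of [a i], except for the live one at offset 0,
       which is split into this value and a correction. *)
    rewrite (eq_bigr (fun t : 'I_(pm i) => - (lam i * q i ^+ t * (a i)^-1) + lam i * q i ^+ t *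
          (if val t == 0%N then a i ^+ 3 + (a i)^-1 else 0))) => [|t _]; last first.
      by case: ifP => _; ring.
    rewrite big_split /= sumrN sum_lam // (sum_pick (fun t => lam i * q i ^+ t)) //.
    rewrite opprK expr0 mulr1 /X /Y; move: ((_ + _) ^+ _) => u; rewrite a_pm /lam.
    by move: (_ ^+ _) => v; rewrite (asign_d i); field.
  by rewrite big1 // => t _; rewrite mulr0.
have [eq_ij|neq_ij] := eqVneq i j; last by rewrite big1 // => t _; rewrite mulr0.
rewrite (eq_bigr (fun t : 'I_(pm i) => lam i * q i ^+ t * (if val t == s.+1 then a i else 0)
   + lam i * q i ^+ t * (if val t == s then a i ^- 3 else 0))) => [|t _]; last first.
  rewrite -mulrDr eqSS /=; congr (_ * _); case: eqVneq => [->|_]; last by rewrite add0r.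
  by rewrite (gtn_eqF (ltnSn s)) addr0.
rewrite big_split /= !(sum_pick (fun t => lam i * q i ^+ t)) ?eq_ij //; last exact: ltnW.
by rewrite -eq_ij exprSr q0; move: (lam i) (_ ^+ s) => u v; field.
Qed.

Lemma eq_crossing (c e : 'I_n) :
  colof ns c = colof ns e -> offset c = offset e -> c = e.
Proof.
move=> eq_col eq_off; apply: val_inj => /=.
by rewrite -(pre_offset (ltn_ord c)) -(pre_offset (ltn_ord e)) eq_col eq_off.
Qed.

Lemma leq_crossing (c e : 'I_n) :
  colof ns c = colof ns e -> (offset c <= offset e)%N -> (c <= e)%N.
Proof.
move=> eq_col le_off; rewrite -(pre_offset (ltn_ord c)) -(pre_offset (ltn_ord e)).
by rewrite eq_col leq_add2l.
Qed.

Lemma row_op_mulE (c e : 'I_n) :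
  (row_op_matrix *m model_matrix) c e =
  if offset c != 0%N then model_matrix c e
  else let i := colof ns c in let j := colof ns e in
    if offset e != 0%N then 0
    else if j == 0%N then B i else if j == i then - X i else if j == i.+1 then Y i else 0.
Proof.
rewrite mxE; case: eqVneq => [off_c|off_c] /=; last first.
  rewrite (bigD1 c) //= !mxE /row_op (negPf off_c) !eqxx mul1r big1 ?addr0 // => g neq_gc.
  rewrite !mxE /row_op (negPf off_c); case: eqVneq => [eq_col|]; last by rewrite mul0r.
  case: eqVneq => [eq_off|]; last by rewrite mul0r.
  by case/eqP: neq_gc; apply: eq_crossing.
have lt_c := colof_lt (ltn_ord c).
rewrite -special_row ?colof_lt ?offset_lt //.
pose G g := row_op (colof ns c) (offset c) (colof ns g) (offset g) *
  model_entry (colof ns g) (offset g) (colof ns e) (offset e).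
rewrite (eq_bigr (fun g : 'I_n => G g)) => [|g _]; last by rewrite !mxE.
rewrite (sum_offsets ns _ G) (bigD1 (Ordinal lt_c)) //= [Z in _ + Z]big1 ?addr0 => [|j].
  by apply: eq_bigr => t _; rewrite /G colof_pre // offset_pre // /row_op off_c !eqxx.
rewrite -val_eqE /= eq_sym => neq_j; rewrite big1 // => t _.
by rewrite /G colof_pre // offset_pre // /row_op off_c (negPf neq_j) mul0r.
Qed.

Lemma prod_offsets (G : nat -> nat -> F) :
  \prod_(c < n) G (colof ns c) (offset c) = \prod_(i < k) \prod_(t < pm i) G i t.
Proof.
rewrite (sum_offsets ns _ (fun c => G (colof ns c) (offset c))).
by apply: eq_bigr => i _; apply: eq_bigr => t _; rewrite colof_pre ?offset_pre.
Qed.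

Lemma det_row_op : \det row_op_matrix = \prod_(i < k) lam i.
Proof.
rewrite (@det_trig_rank _ _ _ val val_inj); last first.
  move=> c e; rewrite mxE /row_op.
  have [off_c|_] := eqVneq (offset c) 0%N;
  have [eq_col|_] := eqVneq (colof ns c) (colof ns e); rewrite ?eqxx // => nz.
    by apply: leq_crossing; rewrite ?off_c.
  by apply: leq_crossing => //; move: nz; case: (eqVneq (offset c)) => [->|]; rewrite ?eqxx.
rewrite (eq_bigr (fun c : 'I_n => row_op (colof ns c) (offset c) (colof ns c) (offset c)));
  last by move=> c _; rewrite mxE.
rewrite (prod_offsets (fun i t => row_op i t i t)); apply: eq_bigr => i _.
rewrite (bigD1 (Ordinal (pm_gt0 ns_neq0 (ltn_ord i)))) //= big1 => [|t].
  by rewrite /row_op !eqxx expr0 !mulr1.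
by rewrite -val_eqE /row_op /= => /negPf->; rewrite !eqxx.
Qed.

Let S := [pred c : 'I_n | offset c != 0%N].

(** With the crossings at offset 0 listed first, the upper right block vanishes. The first diagonal
    block is the Hessenberg matrix; the other one is triangular for the crossing order, with entries
    [a i] on the diagonal. *)
Lemma det_row_op_mul :
  \det (row_op_matrix *m model_matrix) =
  \det (hessenberg B (fun i => - X i) Y k) * \prod_(i < k) a i ^+ (pm i).-1.
Proof.
have lt_pre (i : 'I_k) : (pre i < n)%N.
  by rewrite -(addn0 (pre i)) ltn_ncross ?pm_gt0.
pose sp i := Ordinal (lt_pre i).
have sp_col i : colof ns (sp i) = i by rewrite /= -(addn0 (pre i)) colof_pre ?pm_gt0.
have sp_off i : offset (sp i) = 0%N by rewrite /= -(addn0 (pre i)) offset_pre ?pm_gt0.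
pose f (x : 'I_(k + #|S|)) := match split x with inl i => sp i | inr j => enum_val j end.
have S_off (j : 'I_#|S|) : offset (enum_val j) != 0%N by have := enum_valP j; rewrite inE.
have f_inj : injective f.
  move=> x y; rewrite /f -{2}(splitK x) -{2}(splitK y).
  case: (split x) => i; case: (split y) => j.
  - by move/(congr1 (fun c : 'I_n => colof ns c)); rewrite !sp_col => /val_inj->.
  - by move=> eq_x; have := S_off j; rewrite -eq_x sp_off.
  - by move=> eq_x; have := S_off i; rewrite eq_x sp_off.
  by move/enum_val_inj->.
have f_bij : bijective f.
  (* Surjectivity by counting: the complement of [S] lies in the image of [sp], hence has at most
     [k] elements. *)
  apply: (inj_card_bij f_inj); rewrite !card_ord -{1}(card_ord n) -(cardC S) addnC leq_add2r.
  rewrite -[Z in (_ <= Z)%N](card_ord k); apply: leq_trans (leq_image_card sp predT).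
  apply/subset_leq_card/subsetP => c; rewrite !inE negbK => /eqP off_c.
  apply/imageP; exists (cidx c) => //; apply: eq_crossing; first by rewrite sp_col.
  by rewrite sp_off.
rewrite -(det_mxsub_bij _ f_bij).
have : forall x y, mxsub f f (row_op_matrix *m model_matrix) x y =
                   (row_op_matrix *m model_matrix) (f x) (f y) by move=> x y; rewrite mxE.
move: (mxsub f f _) => M ME; rewrite -[M]submxK.
have -> : ursubmx M = 0.
  apply/matrixP=> i j; rewrite !mxE !ME row_op_mulE /f.
  have -> : split (lshift #|S| i) = inl i by apply: (canLR (@unsplitK _ _)).
  have -> : split (rshift k j) = inr j by apply: (canLR (@unsplitK _ _)).
  by rewrite sp_off eqxx S_off.
rewrite det_lblock; congr (_ * _).
  congr (\det _); apply/matrixP=> i j; rewrite !mxE !ME row_op_mulE /f.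
  have -> : split (lshift #|S| i) = inl i by apply: (canLR (@unsplitK _ _)).
  have -> : split (lshift #|S| j) = inl j by apply: (canLR (@unsplitK _ _)).
  by rewrite !sp_off eqxx !sp_col.
have drE i j : drsubmx M i j = model_matrix (enum_val i) (enum_val j).
  rewrite !mxE !ME row_op_mulE /f.
  have -> : split (rshift k i) = inr i by apply: (canLR (@unsplitK _ _)).
  have -> : split (rshift k j) = inr j by apply: (canLR (@unsplitK _ _)).
  by rewrite S_off mxE.
have h_inj : injective (fun j : 'I_#|S| => val (enum_val j)).
  by move=> i j /val_inj/enum_val_inj.
rewrite (det_trig_rank h_inj); last first.
  move=> i j; rewrite drE mxE /model_entry S_off.
  case: (eqVneq (colof _ _) _) => [eq_col|_]; rewrite ?eqxx // => nz; apply: leq_crossing => //.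
  move: nz; case: (eqVneq (offset (enum_val i)) _) => [->//|_].
  by case: (eqVneq (offset (enum_val i)).+1 _) => [<-//|_]; rewrite eqxx.
transitivity (\prod_(c in S) a (colof ns c)).
  rewrite [RHS]big_enum_val /=; apply: eq_bigr => j _.
  by rewrite drE mxE /model_entry S_off !eqxx.
rewrite big_mkcond /= (eq_bigr (fun c : 'I_n => if offset c != 0%N then a (colof ns c) else 1)) //.
rewrite (prod_offsets (fun i t => if t != 0%N then a i else 1)); apply: eq_bigr => i _.
have := pm_gt0 ns_neq0 (ltn_ord i); case: (pm i) => // m _.
by rewrite big_ord_recl mul1r prodr_const card_ord.
Qed.

(** For [i > 0] one has [d * B i = Y i - X i], so that the mixed products cancel in the recursion.
    It starts from [d * B 0 = Y 0 + (d ^+ 2 - 1) * X 0]. *)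
Lemma det_hessenberg_XY m :
  d * \det (hessenberg B (fun i => - X i) Y m.+1) =
  (-1) ^+ m * (\prod_(i < m.+1) Y i + (d ^+ 2 - 1) * \prod_(i < m.+1) X i).
Proof.
have YX i : Y i = X i + d ^+ 2 * a i ^+ pm i by rewrite /Y /X; ring.
elim: m => [|m IHm].
  rewrite det_mx11 mxE /= !big_ord1 YX /B /X /= expr0 mul1r.
  by move: (_ ^+ _) (a 0 ^+ _) => u v; ring.
rewrite det_hessenbergS mulrDr mulrCA IHm !(big_ord_recr m.+1) /= YX /B /=.
rewrite (exprS (-1)); move: (\prod_(i < m.+1) _) (\prod_(i < m.+1) _) ((-1) ^+ m) => *.
by move: (X _) (a _ ^+ _) => *; ring.
Qed.

Lemma det_model :
  d ^+ k.+1 * \det model_matrix =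
  - (\prod_(i < k) Y i + (d ^+ 2 - 1) * \prod_(i < k) X i).
Proof.
have := det_row_op_mul; rewrite det_mulmx det_row_op big_split /= prodr_const card_ord.
have a_neq0 : \prod_(i < k) a i ^+ (pm i).-1 != 0.
  by apply/prodf_neq0 => i _; rewrite expf_neq0 ?asign_neq0.
rewrite mulrAC => /(mulIf a_neq0) E.
have eq_k : k.-1.+1 = k by rewrite prednK.
have := det_hessenberg_XY k.-1; rewrite eq_k -E.
move: (\det model_matrix) (_ + _ * _) => D W H.
have sgn j : (-1) ^+ j * (-1) ^+ j = 1 :> F by rewrite -expr2 sqrr_sign.
transitivity ((-1) ^+ k * (d * ((- d) ^+ k * D))).
  rewrite (exprNn d) (exprS d) -[LHS]mul1r -[Z in Z * _ = _](sgn k).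
  move: ((-1) ^+ k) (d ^+ k) => u v; ring.
have sgnS : (-1) ^+ k * (-1) ^+ k.-1 = -1 :> F by rewrite -{1}eq_k exprS -mulrA sgn mulr1.
by rewrite H mulrA sgnS mulN1r.
Qed.

End ModelMatrix.

(** * Orientation and the Kasteleyn signs *)

Lemma sign_gauge (R : comPzRingType) (b e f : bool) (w v : R) : b = e (+) f ->
  (if b then -1 else 1) * w * v = (-1) ^+ e * w * v * (-1) ^+ f.
Proof. by move=> ->; case: e; case: f; rewrite /= ?expr0 ?expr1; ring. Qed.

(** This version serves where the activity value is the opposite of the model entry. *)
Lemma sign_gaugeN (R : comPzRingType) (b e f : bool) (w v : R) : b = ~~ (e (+) f) ->
  (if b then -1 else 1) * w * (- v) = (-1) ^+ e * w * v * (-1) ^+ f.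
Proof. by move=> ->; case: e; case: f; rewrite /= ?expr0 ?expr1; ring. Qed.

Section Gauge.
Variable ns : seq int.
Hypothesis ns_neq0 : all (fun z : int => z != 0) ns.
Hypothesis k_gt0 : (0 < size ns)%N.
Local Notation k := (pk ns).
Local Notation pm := (pm ns).
Local Notation pre := (pre ns).
Local Notation n := (ncross ns).
Variable c0 : 'I_n.
Variable o : port ns -> bool.
Hypothesis o_orient : is_orientation o.

Let nw i r := o (prt c0 i r 1).
Let ne i r := o (prt c0 i r 0).

Lemma orient_arc x y : arcrel x y -> o y = ~~ o x.
Proof. by case: o_orient => arc _ /arc; case: (o x); case: (o y). Qed.

Lemma orient_thru (c : 'I_n) p : (p < 2)%N -> o (pt c p.+2) = ~~ o (pt c p).
Proof.
case: o_orient => _ thru lt_p; have := thru (pt c p) (pt c p.+2).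
suff -> : thrurel (pt c p) (pt c p.+2).
  by move/(_ isT); case: (o (pt c p)); case: (o _).
by rewrite /thrurel /= eqxx !inordK ?ltn_mod //; case: p lt_p => [|[|]].
Qed.

Lemma pt_nw (c : 'I_n) : o (pt c 1) = nw (colof ns c) (rowof ns c).
Proof. by rewrite /nw [pt c 1](portE ns_neq0 c0) /= inordK. Qed.

Lemma pt_ne (c : 'I_n) : o (pt c 0) = ne (colof ns c) (rowof ns c).
Proof. by rewrite /ne [pt c 0](portE ns_neq0 c0) /= inordK. Qed.

Lemma pt_prt i r p : (i < k)%N -> (r < pm i)%N -> (p < 4)%N ->
  prt c0 i r p = pt (insubd c0 (xing ns i r)) p.
Proof. by move=> lt_i lt_r lt_p; rewrite /prt /pt modn_small. Qed.

Lemma prt_sw i r : (i < k)%N -> (r < pm i)%N -> o (prt c0 i r 2) = ~~ ne i r.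
Proof. by move=> lt_i lt_r; rewrite pt_prt // orient_thru // -pt_prt. Qed.

Lemma prt_se i r : (i < k)%N -> (r < pm i)%N -> o (prt c0 i r 3) = ~~ nw i r.
Proof. by move=> lt_i lt_r; rewrite pt_prt // orient_thru // -pt_prt. Qed.

Lemma nwS i r : (i < k)%N -> (r.+1 < pm i)%N -> nw i r.+1 = ne i r.
Proof.
move=> lt_i lt_r; rewrite /nw (orient_arc (arc_left ns_neq0 c0 lt_i lt_r)).
by rewrite (prt_sw lt_i (ltnW lt_r)) negbK.
Qed.

Lemma neS i r : (i < k)%N -> (r.+1 < pm i)%N -> ne i r.+1 = nw i r.
Proof.
move=> lt_i lt_r; rewrite /ne (orient_arc (arc_right ns_neq0 c0 lt_i lt_r)).
by rewrite (prt_se lt_i (ltnW lt_r)) negbK.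
Qed.

(** Going down one row exchanges the two orientation bits. *)
Lemma column_parity i r : (i < k)%N -> (r < pm i)%N ->
  nw i r (+) ne i r = nw i 0 (+) ne i 0.
Proof.
move=> lt_i; elim: r => [|r IHr] lt_r //.
by rewrite nwS // neS // addbC IHr // ltnW.
Qed.

Lemma cnextE i : (i.+1 < k)%N -> cnext ns i = i.+1.
Proof. exact: modn_small. Qed.

Lemma nw_next i : (i.+1 < k)%N -> nw i.+1 0 = ~~ ne i 0.
Proof.
move=> lt_i; have := arc_top ns_neq0 c0 (ltnW lt_i).
by rewrite cnextE // => /orient_arc.
Qed.

Lemma ne_next i : (i.+1 < k)%N -> ne i.+1 (pm i.+1).-1 = ~~ nw i (pm i).-1.
Proof.
move=> lt_i; have := arc_bot ns_neq0 c0 (ltnW lt_i).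
rewrite cnextE // => /orient_arc.
rewrite (prt_sw lt_i (pm_last ns_neq0 lt_i)) (prt_se (ltnW lt_i) (pm_last ns_neq0 (ltnW lt_i))).
by move=> /(congr1 negb); rewrite !negbK.
Qed.

(** The lower deck meets every column, so its column sign must be the same seen from each of them.
    Top and bottom arcs to the next column negate one bit each, and [column_parity] relates the two
    rows. *)
Lemma bottom_invariant i : (i < k)%N ->
  ne i (pm i).-1 (+) nw i 0 = ne 0 (pm 0).-1 (+) nw 0 0.
Proof.
elim: i => [|i IHi] // lt_i; rewrite -IHi ?(ltnW lt_i) // ne_next // nw_next //.
have := column_parity (ltnW lt_i) (pm_last ns_neq0 (ltnW lt_i)).
by case: (nw i _); case: (ne i _); case: (nw i 0); case: (ne i 0).
Qed.

(** In a column [j > 0], numbered upwards, the crossings at offsets [s - 1] and [s] are in rows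
    [pm j - s] and [pm j - 1 - s]; an inner region is named after the upper row. *)
Definition col_region (j s : nat) : region :=
  if s != 0%N then RIn j (if j == 0%N then s.-1 else (pm j - 1 - s)%N)
  else if j == 0%N then RBot else RW j.-1.

(* [kappa] and the constant signs [N, W : +], [S, E : -] differ by these row and
   column signs.  The summand [j != 0] makes up for the reversed numbering of the
   columns other than column 0. *)
Definition row_sign (c : 'I_n) : bool :=
  (nw (colof ns c) (rowof ns c) && ~~ ne (colof ns c) (rowof ns c)) (+) nw (colof ns c) 0.

Definition col_sign (j s : nat) : bool :=
  if s != 0%N then nw j (if j == 0%N then s else (pm j - s)%N) (+) nw j 0 (+) (j != 0%N)
  else if j == 0%N then ne 0 (pm 0).-1 (+) nw 0 0 else nw j 0.

(** Only the unbounded region can occupy two corners of a crossing: east and west when there is a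
    single column. *)
Lemma corner_inj (c : 'I_n) p q : (p < 4)%N -> (q < 4)%N ->
  corner ns c p = corner ns c q -> corner ns c p <> RU -> p = q.
Proof.
case: p => [|[|[|[|//]]]] _; case: q => [|[|[|[|//]]]] _ //=;
  do ?[case: eqP => //= ?]; move=> [] //; lia.
Qed.

Lemma kappaE (c : 'I_n) q R : (q < 4)%N -> corner ns c q = R -> R <> RU ->
  kappa o c R = if o (pt c q) && o (pt c q.+1) then -1 else 1.
Proof.
move=> lt_q cq nRU; rewrite /kappa; congr (if _ then _ else _).
apply/existsP/idP => [[p /and3P[p0 p1 /eqP cp]]|/andP[q0 q1]]; last first.
  by exists (Ordinal lt_q); rewrite /= q0 q1 cq eqxx.
suff <- : val p = q by rewrite p0.
by apply: (@corner_inj c _ _ (ltn_ord p) lt_q); rewrite (cp : corner ns c p = R) ?cq.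
Qed.

Lemma incident_corner c q R : (q < 4)%N -> corner ns c q = R -> incident ns c R.
Proof. by move=> lt_q cq; apply/existsP; exists (Ordinal lt_q); rewrite /= cq. Qed.

Lemma MentryE (c : 'I_n) q R : (q < 4)%N -> corner ns c q = R -> R <> RU ->
  Mentry o c R = (if o (pt c q) && o (pt c q.+1) then -1 else 1) * wfactor o c *
    (if black R then if live c R then - asign ns varA (colof ns c) ^- 3
                     else asign ns varA (colof ns c)
     else if live c R then - asign ns varA (colof ns c) ^+ 3
          else (asign ns varA (colof ns c))^-1).
Proof.
by move=> lt_q cq nRU; rewrite /Mentry (incident_corner lt_q cq) (kappaE lt_q cq nRU).
Qed.

(** * Incidence and liveness of the regions *)

Lemma liveE (c c1 : 'I_n) R : incident ns c1 R ->
  (forall c' : 'I_n, incident ns c' R -> (c1 <= c')%N) -> live c R = (c <= c1)%N.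
Proof.
move=> inc1 min1; apply/forallP/idP => [/(_ c1)|le_c c']; first by rewrite inc1.
by apply/implyP => /min1; apply: leq_trans.
Qed.

Lemma rowof_offset (c : 'I_n) : rowof ns c = flip ns (colof ns c) (offset ns c).
Proof. by rewrite -{1}(pre_offset (ltn_ord c)) rowof_pre ?colof_lt ?offset_lt. Qed.

Lemma incident_in (c : 'I_n) j r : (r.+1 < pm j)%N ->
  incident ns c (RIn j r) = (colof ns c == j) && ((rowof ns c == r.+1) || (rowof ns c == r)).
Proof.
move=> lt_r; apply/existsP/andP => [[q /eqP]|[/eqP eq_j /orP[] /eqP eq_r]].
- case: q => [[|[|[|[|//]]]] ?] /=; do ?[case: ifP => //=] => nr [<- <-];
  split; rewrite ?eqxx ?orbT //.
  by rewrite prednK ?eqxx // lt0n nr.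
- by exists (Ordinal (isT : 0 < 4)%N); rewrite /= eq_r eq_j.
exists (Ordinal (isT : 2 < 4)%N); rewrite /= eq_r eq_j ifF //.
by apply: ltn_eqF; lia.
Qed.

Lemma incident_bot (c : 'I_n) : incident ns c RBot = (rowof ns c == (pm (colof ns c)).-1).
Proof.
apply/existsP/eqP => [[q /eqP]|eq_r]; last first.
  by exists (Ordinal (isT : 2 < 4)%N); rewrite /= eq_r eqxx.
by case: q => [[|[|[|[|//]]]] ?] /=; do ?[case: ifP => //=] => /eqP.
Qed.

Lemma incident_w (c : 'I_n) j : (j.+1 < k)%N ->
  incident ns c (RW j) = (colof ns c == j) || (colof ns c == j.+1).
Proof.
move=> lt_j; apply/existsP/orP => [[q /eqP]|[] /eqP eq_i].
- case: q => [[|[|[|[|//]]]] ?] /=; do ?[case: ifP => //=] => ni [<-].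
    by right; rewrite prednK ?eqxx // lt0n ni.
  by left.
- exists (Ordinal (isT : 3 < 4)%N); rewrite /= eq_i ifF //.
  by apply: ltn_eqF; lia.
by exists (Ordinal (isT : 1 < 4)%N); rewrite /= eq_i.
Qed.

Lemma incident_in_offset (c : 'I_n) j s : (s.+1 < pm j)%N ->
  incident ns c (col_region j s.+1) =
  (colof ns c == j) && ((offset ns c == s) || (offset ns c == s.+1)).
Proof.
move=> lt_s; rewrite /col_region /= incident_in; last by case: eqP => _; lia.
have := offset_lt (ltn_ord c); rewrite rowof_offset /flip.
case: (eqVneq _ j) => //= -> lt_o; case: (eqVneq j 0%N) => _ /=; lia.
Qed.

Lemma live_in (c : 'I_n) j s : (j < k)%N -> (s.+1 < pm j)%N -> colof ns c = j ->
  live c (col_region j s.+1) = (offset ns c <= s)%N.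
Proof.
move=> lt_j lt_s eq_j; pose c1 := Ordinal (ltn_ncross lt_j (ltnW lt_s)).
rewrite (@liveE c c1).
- by rewrite -{1}(pre_offset (ltn_ord c)) eq_j /= leq_add2l.
- by rewrite incident_in_offset //= colof_pre ?offset_pre ?eqxx // ltnW.
move=> c'; rewrite incident_in_offset // => /andP[/eqP eq_c' off_c'].
rewrite -(pre_offset (ltn_ord c')) eq_c' /= leq_add2l.
by case/orP: off_c' => /eqP->.
Qed.

(** The bottom crossing of column 0 comes last in its column but before all other columns, and it is
    the only one of column 0 on the lower deck. *)
Lemma live_bot (c : 'I_n) : incident ns c RBot -> live c RBot = (colof ns c == 0%N).
Proof.
move=> inc; have lt_l := pm_last ns_neq0 k_gt0.
pose c1 : 'I_n := Ordinal (ltn_ncross k_gt0 lt_l).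
have last_col (c' : 'I_n) : (colof ns c' != 0)%N -> (c1 < c')%N.
  move=> nz; apply: (@leq_trans (pre 1)); first exact: (@ltn_pre ns 0 1 _ isT lt_l).
  rewrite -(pre_offset (ltn_ord c')); apply: leq_trans (leq_addr _ _).
  by apply: leq_pre; rewrite lt0n.
have bot0 (c' : 'I_n) : incident ns c' RBot -> colof ns c' = 0%N -> c' = c1.
  rewrite incident_bot rowof_offset /flip => /eqP + eq_c; rewrite eq_c eqxx => off_c.
  by apply: eq_crossing; rewrite ?eq_c ?off_c /= ?colof_pre ?offset_pre.
rewrite (@liveE c c1).
- case: eqVneq => [/(bot0 _ inc)->|/last_col]; first exact: leqnn.
  by rewrite ltnNge => /negbTE.
- by rewrite incident_bot rowof_offset /= colof_pre // offset_pre.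
move=> c' inc'; have [/(bot0 _ inc')-> //|/last_col/ltnW//] := eqVneq (colof ns c') 0%N.
Qed.

Lemma live_w (c : 'I_n) j : (j.+1 < k)%N -> incident ns c (RW j) ->
  live c (RW j) = (colof ns c == j) && (offset ns c == 0%N).
Proof.
move=> lt_j inc; have pm_j := pm_gt0 ns_neq0 (ltnW lt_j).
pose c1 := Ordinal (ltn_ncross (ltnW lt_j) pm_j).
rewrite (@liveE c c1).
- have := inc; rewrite incident_w // -{3}(pre_offset (ltn_ord c)) /= => /orP[] /eqP->.
    by rewrite eqxx leq_add2l leqn0.
  rewrite (gtn_eqF (ltnSn j)) preS; lia.
- by rewrite incident_w //= colof_pre ?eqxx // ltnW.
move=> c'; rewrite incident_w // -{3}(pre_offset (ltn_ord c')) /= addn0 => /orP[] /eqP->.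
  exact: leq_addr.
by rewrite preS -addnA leq_addr.
Qed.

(** Each case locates the corner where the region lies, decides liveness, and compares the
    orientation bits of the two ends at this corner with the row and column signs. *)
Lemma Mentry_gauge (c : 'I_n) j s : (j < k)%N -> (s < pm j)%N ->
  Mentry o c (col_region j s) =
  (-1) ^+ row_sign c * wfactor o c *
  model_entry ns varA (colof ns c) (offset ns c) j s * (-1) ^+ col_sign j s.
Proof.
move=> lt_j lt_s.
have lt_i := colof_lt (ltn_ord c); have lt_t := offset_lt (ltn_ord c).
have row_c := rowof_offset c.
have lt_r : (rowof ns c < pm (colof ns c))%N := rowof_lt ns_neq0 (ltn_ord c).
have par := column_parity lt_i lt_r.
have o1 := pt_nw c; have o0 := pt_ne c.
have o2 : o (pt c 2) = ~~ ne (colof ns c) (rowof ns c) by rewrite orient_thru // o0.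
have o3 : o (pt c 3) = ~~ nw (colof ns c) (rowof ns c) by rewrite orient_thru // o1.
have o4 : o (pt c 4) = ne (colof ns c) (rowof ns c) by rewrite -o0.
rewrite /model_entry; case: s lt_s => [|s] lt_s; rewrite [_ != _]/=; last first.
  case: eqVneq => [eq_ij|neq_ij]; last first.
    by rewrite mulr0 mul0r /Mentry incident_in_offset ?(negPf neq_ij).
  have [eq_t|neq_t] := eqVneq (offset ns c) s.+1.
    have Lv : live c (col_region j s.+1) = false by rewrite live_in // eq_t ltnn.
    have [j0|nj0] := eqVneq j 0%N.
      rewrite (@MentryE c 0) //; last first.
        by rewrite /col_region /= row_c /flip eq_ij j0 eqxx eq_t.
      rewrite Lv [black _]/=; apply: sign_gauge.
      rewrite o0 o1 /row_sign /col_sign /= j0 eqxx row_c /flip eq_ij j0 eqxx eq_t.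
      by case: (nw 0 s.+1); case: (ne 0 s.+1); case: (nw 0 0).
    have eq_r : rowof ns c = (pm j - 1 - s.+1)%N by rewrite row_c /flip eq_ij (negPf nj0) eq_t.
    have eq_rS : (pm j - s.+1)%N = (rowof ns c).+1.
      by rewrite eq_r; move: lt_s; clear; lia.
    have lt_rS : ((rowof ns c).+1 < pm j)%N by rewrite -eq_rS; move: lt_s; clear; lia.
    rewrite (@MentryE c 2) //; last first.
      rewrite /col_region /= (negPf nj0) -eq_r eq_ij ifF //.
      by apply: ltn_eqF; move: lt_rS; clear; lia.
    rewrite Lv [black _]/=; apply: sign_gauge.
    rewrite o2 o3 /row_sign /col_sign /= (negPf nj0) eq_rS eq_ij nwS //.
    by case: (nw j _); case: (ne j _); case: (nw j 0).
  have [eq_t1|neq_t'] := eqVneq (offset ns c).+1 s.+1; last first.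
    rewrite mulr0 mul0r /Mentry incident_in_offset // eq_ij eqxx (negPf neq_t).
    by rewrite orbF -eqSS (negPf neq_t').
  have eq_t : offset ns c = s by case: eq_t1.
  have Lv : live c (col_region j s.+1) by rewrite live_in // eq_t.
  have [j0|nj0] := eqVneq j 0%N.
    have lt_s0 : (s.+1 < pm 0)%N by rewrite -j0.
    have eq_r : rowof ns c = s by rewrite row_c /flip eq_ij j0 eqxx.
    rewrite (@MentryE c 2) //; last first.
      rewrite /col_region /= eq_r eq_ij j0 ifF //.
      by apply: ltn_eqF; rewrite -j0; move: lt_s; clear; lia.
    rewrite Lv [black _]/=; apply: sign_gaugeN.
    rewrite o2 o3 /row_sign /col_sign /= eq_r eq_ij j0 eqxx (nwS k_gt0 lt_s0).
    by case: (nw 0 s); case: (ne 0 s); case: (nw 0 0).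
  have eq_r : rowof ns c = (pm j - s.+1)%N.
    by rewrite row_c /flip eq_ij (negPf nj0) eq_t; move: lt_s; clear; lia.
  rewrite (@MentryE c 0) //; last first.
    rewrite /col_region /= (negPf nj0) eq_r eq_ij ifF; last first.
      by apply: gtn_eqF; move: lt_s; clear; lia.
    by congr RIn; move: lt_s; clear; lia.
  rewrite Lv [black _]/=; apply: sign_gaugeN.
  rewrite o0 o1 /row_sign /col_sign /= (negPf nj0) -eq_r eq_ij.
  by case: (nw j _); case: (ne j _); case: (nw j 0).
have [j0|nj0] := eqVneq j 0%N.
  rewrite j0 (_ : col_region 0 0 = RBot) //.
  have [inc|ninc] := boolP (incident ns c RBot); last first.
    rewrite /Mentry (negPf ninc).
    move: ninc; rewrite incident_bot row_c /flip; case: (eqVneq (colof ns c) 0%N) => [->|_] ninc.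
      rewrite ifF ?mulr0 ?mul0r //; move: ninc.
      by rewrite -{2}(prednK (pm_gt0 ns_neq0 k_gt0)) eqSS => /negbTE.
    rewrite ifF ?mulr0 ?mul0r //; apply: contraNF ninc => /eqP->.
    by rewrite subn0 subn1.
  have eq_r : rowof ns c = (pm (colof ns c)).-1 by move: inc; rewrite incident_bot => /eqP.
  rewrite (@MentryE c 2) //; last by rewrite /= eq_r eqxx.
  rewrite (live_bot inc) [black _]/=; have [i0|ni0] := eqVneq (colof ns c) 0%N.
    have -> : ((offset ns c).+1 == pm 0)%N.
      move: eq_r; rewrite row_c /flip i0 eqxx => ->.
      by rewrite prednK // pm_gt0.
    apply: sign_gaugeN; rewrite o2 o3 /row_sign /col_sign /= eq_r i0.
    by case: (nw 0 _); case: (ne 0 _); case: (nw 0 0).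
  have -> : offset ns c == 0%N.
    by move: eq_r; rewrite row_c /flip (negPf ni0); move: lt_t; clear; lia.
  (* The activity value is [a] and the model entry [- a], because the south corner carries the
     constant sign [-1]. *)
  rewrite -[Z in _ * Z = _]opprK; apply: sign_gaugeN.
  rewrite o2 o3 /row_sign /col_sign /= -(bottom_invariant lt_i) eq_r.
  by case: (nw _ _); case: (ne _ _); case: (nw _ 0).
have eq_j : j = j.-1.+1 by rewrite prednK // lt0n.
have -> : col_region j 0 = RW j.-1 by rewrite /col_region /= (negPf nj0).
have inc_w := @incident_w c j.-1; rewrite -eq_j in inc_w.
have live_w' := @live_w c j.-1; rewrite -eq_j in live_w'.
have [eq_ij|neq_ij] := eqVneq (colof ns c) j.
  rewrite (@MentryE c 1) //; last by rewrite /= eq_ij (negPf nj0).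
  rewrite live_w' ?inc_w ?eq_ij ?eqxx ?orbT // [in j == j.-1]eq_j (gtn_eqF (ltnSn _)) [black _]/=.
  apply: sign_gauge; rewrite o1 o2 /row_sign /col_sign /= (negPf nj0) eq_ij.
  by case: (nw j _); case: (ne j _); case: (nw j 0).
have [eq_ij|neq_ij'] := eqVneq (colof ns c).+1 j; last first.
  rewrite mulr0 mul0r /Mentry inc_w // (negPf neq_ij) orbF ifF //.
  by apply: contraNF neq_ij' => /eqP->; rewrite -eq_j.
(* The east corner lies between ends 3 and 4, the latter being end 0. Its bits belong to the current
   row, whereas the sign of the region is read in the top row; [par] links the two. *)
have bits : o (pt c 3) && o (pt c 4) = ~~ (row_sign c (+) col_sign j 0).
  rewrite o3 o4 /row_sign /col_sign /= (negPf nj0) -eq_ij nw_next ?eq_ij //.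
  move: par; case: (nw _ (rowof _ _)); case: (ne _ (rowof _ _));
  by case: (nw _ 0); case: (ne _ 0).
have eq_i : colof ns c = j.-1 by rewrite -eq_ij.
rewrite (@MentryE c 3) //; last first.
  by rewrite /= eq_i ifF //; apply: ltn_eqF; move: lt_j nj0; clear; lia.
rewrite live_w' ?inc_w ?eq_i ?eqxx // [black _]/= [true && _]/=.
case: (offset ns c == 0%N); first exact: sign_gaugeN.
by rewrite -[Z in _ * Z = _]opprK; apply: sign_gaugeN.
Qed.

End Gauge.

(** * The determinant formula *)

Lemma det_scaled (R : comNzRingType) m (f g : 'I_m -> R) (M : 'M[R]_m) :
  \det (\matrix_(i, j) (f i * M i j * g j)) = (\prod_i f i) * \det M * \prod_j g j.
Proof.
have -> : \matrix_(i, j) (f i * M i j * g j) =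
    diag_mx (\row_i f i) *m M *m diag_mx (\row_j g j).
  by apply/matrixP=> i j; rewrite mul_mx_diag mul_diag_mx !mxE.
rewrite !det_mulmx !det_diag.
by congr (_ * _ * _); apply: eq_bigr => i _; rewrite mxE.
Qed.

Lemma sqr_prod_sign (R : comNzRingType) m (e : 'I_m -> bool) :
  (\prod_i (-1) ^+ e i) ^+ 2 = 1 :> R.
Proof. by rewrite -prodrXl big1 // => i _; rewrite sqrr_sign. Qed.

Lemma sqr_det_col_inj (R : comNzRingType) m (M : 'M[R]_m) (f : 'I_m -> 'I_m) :
  injective f -> \det (\matrix_(i, j) M i (f j)) ^+ 2 = \det M ^+ 2.
Proof.
move=> f_inj.
have -> : \matrix_(i, j) M i (f j) = col_perm (perm f_inj) M.
  by apply/matrixP=> i j; rewrite !mxE permE.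
by rewrite col_permE det_mulmx det_perm exprMn sqrr_sign mulr1.
Qed.

Lemma prod_sign_exprz (F : fieldType) m (s : 'I_m -> bool) (x : F) : x != 0 ->
  \prod_i (if s i then x^-1 else x) = x ^ (- \sum_i (if s i then 1 else -1)).
Proof.
move=> x0; elim/big_rec2: _ => [|i z y _ ->]; first by rewrite oppr0 expr0z.
by rewrite opprD expfzDr //; case: (s i); rewrite ?opprK // exprN1.
Qed.

(** * Comparison of the two sides *)

Section Main.
Variable ns : seq int.
Hypothesis ns_neq0 : all (fun z : int => z != 0) ns.
Hypothesis k_gt0 : (0 < size ns)%N.
Local Notation k := (pk ns).
Local Notation pm := (pm ns).
Local Notation n := (ncross ns).

Let rho (e : 'I_n) := col_region ns (colof ns e) (offset ns e).

Lemma col_region_inj : injective rho.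
Proof.
move=> c e; have := offset_lt (ltn_ord c); have := offset_lt (ltn_ord e).
rewrite /rho /col_region.
have [c0|nc0] := eqVneq (offset ns c) 0%N; have [e0|ne0] := eqVneq (offset ns e) 0%N;
  rewrite /= => lt_e lt_c.
- case: eqVneq => [cc|ncc]; case: eqVneq => [ce|nce] //.
    by move=> _; apply: eq_crossing; rewrite ?cc ?ce ?c0 ?e0.
  move=> [] /(congr1 succn); rewrite !prednK ?lt0n // => eq_ce.
  by apply: eq_crossing; rewrite ?c0 ?e0.
- by case: (colof ns c == 0%N).
- by case: (colof ns e == 0%N).
move=> [eq_ce]; rewrite -eq_ce in lt_e *.
move=> eq_s; apply: eq_crossing => //.
by move: eq_s nc0 ne0 lt_e lt_c; case: eqP => _; clear; lia.
Qed.

Lemma col_region_ok e : is_region ns (rho e) && ~~ omitted (rho e).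
Proof.
have lt_e := offset_lt (ltn_ord e); have lt_k := colof_lt (ltn_ord e).
have pm0 := pm_last ns_neq0 k_gt0.
rewrite andbC /rho; apply/andP; split.
  by rewrite /col_region; do 2!case: ifP => //.
apply/existsP; case off_e: (offset ns e) lt_e => [|s] lt_e; last first.
  by exists e; rewrite incident_in_offset // off_e !eqxx orbT.
rewrite /col_region /=; have [e0|ne0] := eqVneq (colof ns e) 0%N.
  exists (Ordinal (ltn_ncross k_gt0 pm0)).
  by rewrite incident_bot rowof_offset /= colof_pre // offset_pre.
have eq_e : (colof ns e).-1.+1 = colof ns e by rewrite prednK // lt0n.
by exists e; rewrite incident_w ?eq_e ?eqxx ?orbT.
Qed.

Lemma sqr_det_activity (o : port ns -> bool) (col : 'I_n -> region) :
  is_orientation o -> column_order col ->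
  \det (activity_matrix o col) ^+ 2 =
  (\prod_c wfactor o c) ^+ 2 * \det (model_matrix ns varA) ^+ 2.
Proof.
move=> o_orient [col_inj col_surj].
(* The given order of the regions and the one of the model differ by an injection [s] of the column
   indices, which costs only a sign. *)
have ex_s e : exists j, col j == rho e.
  by have /col_surj[j <-] := col_region_ok e; exists j.
pose s e := xchoose (ex_s e).
have sE e : col (s e) = rho e by apply/eqP/(xchooseP (ex_s e)).
have s_inj : injective s.
  by move=> c e eq_s; apply: col_region_inj; rewrite -!sE eq_s.
rewrite -(sqr_det_col_inj _ s_inj).
pose c0 := Ordinal (ncross_gt0 ns_neq0 k_gt0).
have -> : \matrix_(c, e) activity_matrix o col c (s e) =
  \matrix_(c, e) ((-1) ^+ row_sign c0 o c * wfactor o c * model_matrix ns varA c e *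
                  (-1) ^+ col_sign c0 o (colof ns e) (offset ns e)).
  apply/matrixP=> c e; rewrite !mxE sE /rho (Mentry_gauge ns_neq0 k_gt0 c0 o_orient) ?mxE //.
  - exact: colof_lt.
  exact: offset_lt.
rewrite (det_scaled (fun c => (-1) ^+ row_sign c0 o c * wfactor o c)
                    (fun e : 'I_n => (-1) ^+ col_sign c0 o (colof ns e) (offset ns e))).
by rewrite big_split /= !exprMn !sqr_prod_sign mulr1 mul1r.
Qed.

Lemma tofrac_neq0 (p : {poly int}) : p != 0 -> tofrac p != 0 :> LA.
Proof. by rewrite tofrac_eq0. Qed.

Lemma varA_neq0 : varA != 0.
Proof. by rewrite tofrac_neq0 // polyX_eq0. Qed.

(** Multiplied by [- A ^+ 2], the loop value becomes the nonzero polynomial [A ^+ 4 + 1]. *)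
Lemma loop_value_neq0 : - varA ^+ 2 - varA ^- 2 != 0.
Proof.
rewrite -opprD oppr_eq0; apply/eqP => /(congr1 ( *%R (varA ^+ 2))).
rewrite mulr0 mulrDr divff ?expf_neq0 ?varA_neq0 // -exprD => /eqP.
apply/negP; rewrite -tofracXn -tofrac1 -tofracD tofrac_neq0 //.
by rewrite -size_poly_eq0 size_XnaddC.
Qed.

Lemma prod_wfactor (o : port ns -> bool) :
  \prod_c wfactor o c = (- varA ^+ 3) ^ (- writhe o).
Proof.
rewrite /writhe -prod_sign_exprz ?oppr_eq0 ?expf_neq0 ?varA_neq0 //.
by apply: eq_bigr => c _; rewrite /wfactor invrN.
Qed.

Lemma det_model_kbracket : \det (model_matrix ns varA) = - kbracket ns.
Proof.
apply: (mulfI (expf_neq0 k.+1 loop_value_neq0)).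
rewrite mulrN kbracket_state_sum //=.
by rewrite (det_model ns_neq0 k_gt0 varA_neq0).
Qed.

End Main.

Theorem mainTheorem6 (ns : seq int) :
  (0 < size ns)%N ->
  all (fun z : int => z != 0) ns ->
  is_knot ns ->
  forall (o : port ns -> bool), is_orientation o ->
  forall (col : 'I_(ncross ns) -> region), column_order col ->
  \det (activity_matrix o col) = jonesA o \/
  \det (activity_matrix o col) = - jonesA o.
Proof.
move=> k_gt0 ns_neq0 _ o o_orient col col_ord; apply/pred2P.
(* Squaring absorbs the sign changes of rows and columns, the order of the columns, and the sign in
   [det_model_kbracket]. *)
rewrite -eqf_sqr (sqr_det_activity ns_neq0 k_gt0) // prod_wfactor.
by rewrite det_model_kbracket // sqrrN -exprMn.
Qed.
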